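(* The number of distinct isomorphism classes of 3-manifold triangulations of size $n$ grows at an asymptotic rate of $\exp(\Theta(n\log n))$ as $n \to \infty$.
   Context: A 3-manifold triangulation of size $n$ is a collection of $n$ abstract tetrahedra whose $4n$ faces are affinely identified in $2n$ pairs so that the resulting topological space is a connected closed 3-manifold (not necessarily orientable). Two faces of the same tetrahedron may be identified, and distinct edges or vertices of the same tetrahedron may become identified. Equivalently: the gluing is connected, every vertex of the triangulation has a small regular neighbourhood bounded by a sphere, and no edge of the triangulation is identified with itself in reverse. No restriction is placed on the number of vertices. Two triangulations are isomorphic if they are identical up to relabelling tetrahedra and reordering the four vertices of each tetrahedron. *)

(* Defs.v *)
From HB Require Import structures.
From Stdlib Require Import Relation_Operators.
From mathcomp Require Import all_boot all_order all_algebra all_fingroup.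
From mathcomp Require Import all_classical all_reals all_analysis.
Set Implicit Arguments.
Unset Strict Implicit.
Unset Printing Implicit Defensive.
Import Order.TTheory GRing.Theory Num.Theory.
Import numFieldNormedType.Exports.
Local Open Scope classical_set_scope.
Local Open Scope ring_scope.
Local Open Scope quotient_scope.

Definition homeomorphic (X Y : topologicalType) : Prop :=
  exists (f : X -> Y) (g : Y -> X),
    [/\ continuous f, continuous g, cancel f g & cancel g f].

(* U and V are used as spaces, with the subspace topology on [set_type]. *)
Definition locally_euclidean (R : realType) (k : nat) (M : topologicalType) :
    Prop :=
  forall x : M, exists (U : set M) (V : set 'rV[R]_k),
    [/\ open U, U x, open V & homeomorphic (set_type U) (set_type V)].

(* Charts are open subsets of R^k, so these manifolds have no boundary and
   "closed" amounts to "compact". *)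
Definition manifold (R : realType) (k : nat) (M : topologicalType) : Prop :=
  [/\ hausdorff_space M, @second_countable M & locally_euclidean R k M].

Definition connected_closed_manifold (R : realType) (k : nat)
    (M : topologicalType) : Prop :=
  [/\ manifold R k M, compact [set: M] & connected [set: M]].

(* Face (t, i) is the face of tetrahedron t opposite its vertex i.  If
   G (t, i) = (t', p) then this face is glued to the face of t' opposite the
   vertex p i, the vertex j != i of t being sent to the vertex p j of t'.
   The value p i carries no choice beyond that of the target face, so
   distinct gluings have distinct codes. *)
Definition gluing (n : nat) : finType :=
  {ffun 'I_n * 'I_4 -> 'I_n * {perm 'I_4}}.

Definition mate (n : nat) (G : gluing n) (f : 'I_n * 'I_4) : 'I_n * 'I_4 :=
  ((G f).1, (G f).2 f.2).

(* The 4n faces are matched in pairs of distinct faces, and the two maps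
   attached to a pair are mutually inverse. *)
Definition face_pairing (n : nat) (G : gluing n) : bool :=
  [forall f, [&& mate G f != f,
                 mate G (mate G f) == f &
                 G (mate G f) == (f.1, ((G f).2^-1)%g)]].

Definition simplex3 (R : realType) : set 'rV[R]_4 :=
  [set x | (forall i, 0 <= x ord0 i) /\ \sum_i x ord0 i = 1].

(* Disjoint union of n tetrahedra, in barycentric coordinates. *)
Definition tetrahedra (R : realType) (n : nat) : topologicalType :=
  {t : 'I_n & set_type (@simplex3 R)}.

(* Each face is mapped affinely, i.e. by transporting barycentric
   coordinates. *)
Definition face_glued (R : realType) (n : nat) (G : gluing n)
    (a b : tetrahedra R n) : Prop :=
  exists i : 'I_4,
    [/\ set_val (projT2 a) ord0 i = 0,
        projT1 b = (G (projT1 a, i)).1 &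
        forall j, set_val (projT2 b) ord0 ((G (projT1 a, i)).2 j)
                  = set_val (projT2 a) ord0 j].

Definition identified (R : realType) (n : nat) (G : gluing n) :
    rel (tetrahedra R n) :=
  fun a b => `[< clos_refl_sym_trans _ (@face_glued R n G) a b >].

Lemma identified_is_equiv (R : realType) (n : nat) (G : gluing n) :
  equiv_class_of (@identified R n G).
Proof.
split.
- by move=> a; apply/asboolP; apply: rst_refl.
- by move=> a b; apply/asboolP/asboolP; apply: rst_sym.
- move=> b a c /asboolP ab /asboolP bc; apply/asboolP.
  exact: rst_trans ab bc.
Qed.

Definition identified_equiv (R : realType) (n : nat) (G : gluing n) :
    equiv_rel (tetrahedra R n) :=
  EquivRelPack (@identified_is_equiv R n G).

Definition realization (R : realType) (n : nat) (G : gluing n) :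
    topologicalType :=
  quotient_topology {eq_quot @identified_equiv R n G}.

Definition manifold_triangulation (R : realType) (n : nat) (G : gluing n) :
    Prop :=
  face_pairing G /\ connected_closed_manifold R 3 (realization R G).

(* Tetrahedron t is renamed s t, and its vertex i becomes vertex w t i of s t.
   Composition of permutations reads from left to right. *)
Definition isomorphic (n : nat) : rel (gluing n) := fun G H =>
  [exists s : {perm 'I_n}, exists w : {ffun 'I_n -> {perm 'I_4}},
    forall f : 'I_n * 'I_4,
      H (s f.1, w f.1 f.2)
      == (s (G f).1, ((w f.1)^-1 * (G f).2 * w (G f).1)%g)].

Definition num_triangulations (R : realType) (n : nat) : nat :=
  #|equivalence_partition (@isomorphic n)
      [set G : gluing n | `[< manifold_triangulation R G >]]%SET|.

(* Main.v *)
(** The upper bound counts gluings. For the lower bound, take k pairs of copies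
of the 16-cell, the triangulation of the sphere |z|_1 = 1 of R^4 by its 16
orthants. Three facets of each copy are removed and joined, by tubes S^2 x I, to
facets of copies of the other side of the pairing: two of the three families of
tubes are fixed and make the result connected, the third one follows an
arbitrary permutation of the k pairs. A tube is a 16-cell minus two antipodal
facets; its gluings preserve the numbering of vertices. Coning some of the other facets
adjusts the number of tetrahedra, so that every large n is reached with k
proportional to n. An isomorphism is determined by the image of one tetrahedron,
because it propagates along the faces that all members of the family glue
alike; hence there are at least k! / (24 n) classes.

That such a gluing is a manifold is seen from its maps to R^4, one for each
copy: a copy is sent to the unit sphere, a tube at one of its removed facets is
turned inside out into that facet, its far end is shrunk to 0 together with
everything else. Off the central parts of the removed facets, this map is
injective onto the sphere. *)
From HB Require Import structures.
From Stdlib Require Import Relation_Operators.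
Require Import Defs.
From mathcomp Require Import all_boot all_order all_algebra all_fingroup.
From mathcomp Require Import all_classical all_reals all_analysis.
From mathcomp Require Import lra ring zify.
Set Implicit Arguments.
Unset Strict Implicit.
Unset Printing Implicit Defensive.
Import Order.TTheory GRing.Theory Num.Theory.
Import numFieldNormedType.Exports.
Local Open Scope classical_set_scope.
Local Open Scope ring_scope.

(** * Manifolds from collapsing maps *)

(** An arbitrary gluing may fail to be a manifold at its vertices, so the lower bound needs a family
    of sure manifolds with about n log n bits of free choice. Since manifolds are defined by charts
    on the quotient space, the maps to R^4 take the place of a study of vertex links: a point is
    recovered from one value in R^4, and its chart is one of the sphere.

    The 16-cell suits this because the vertices of a facet are the coordinate vectors up to sign and
    crossing a triangle flips one sign. Hence the gluings outside the cones are the identity on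
    vertex numbers, and coordinates agree across them. A tube is read in R^4 as well, its two ends
    seeing z and -z. The positive parts of z and -z add up to |z|_1 = 1, so one of them exceeds 1/4.
    This is why the shrinking starts at {4 * pos_sum z = 1}: the parts of a tube that its two ends
    keep unshrunk overlap and cover it.

    Connectedness and rigidity rest on the same walk through the tetrahedra, along faces whose
    gluing does not depend on the permutation. *)

Lemma mx_continuous (T U : topologicalType) m n (f : T -> 'M[U]_(m, n)) :
  (forall i j, continuous (fun x => f x i j)) -> continuous f.
Proof.
move=> cf x A [P Px PA].
have : \forall y \near x, forall ij : 'I_m * 'I_n, P ij.1 ij.2 (f y ij.1 ij.2).
  apply: filter_forall => -[i j] /=.
  exact: (cf i j x).
by apply: filterS => y Hy; apply: PA => i j; exact: (Hy (i, j)).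
Qed.

Lemma set_type_continuous (T U : topologicalType) (B : set U)
    (f : T -> set_type B) :
  continuous (fun x => set_val (f x)) -> continuous f.
Proof.
move=> /continuousP cf; apply/continuousP => _ [A oA <-].
exact: (cf A oA).
Qed.

Lemma set_val_continuous (T : topologicalType) (A : set T) :
  continuous (set_val : set_type A -> T).
Proof. exact: initial_continuous. Qed.

Lemma mx_second_countable (R : realType) m n : @second_countable 'M[R]_(m, n).
Proof.
pose box (q : 'M[rat]_(m, n) * 'M[rat]_(m, n)) : set 'M[R]_(m, n) :=
  [set M | forall ij : 'I_m * 'I_n,
     ratr (q.1 ij.1 ij.2) < M ij.1 ij.2 < ratr (q.2 ij.1 ij.2)].
have obox q : open (box q).
  rewrite openE => M qM.
  apply: (@filter_forall _ _ (fun ij => [set N : 'M[R]_(m, n) |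
    ratr (q.1 ij.1 ij.2) < N ij.1 ij.2 < ratr (q.2 ij.1 ij.2)])
    _ (nbhs_filter M)) => -[i j] /=.
  have : \forall x \near M i j, x \in `]ratr (q.1 i j), ratr (q.2 i j)[.
    by apply: near_in_itvoo; rewrite in_itv /=; exact: (qM (i, j)).
  move=> /(@coord_continuous R m n i j M) /=.
  by apply: (@filterS _ _ (nbhs_filter M)) => N /=; rewrite in_itv.
exists (range box); first exact: sub_countable (card_image_le _ _) (countableP _).
split; first by move=> _ [q _ <-]; exact: obox.
move=> M A [P PM PA].
have H (ij : 'I_m * 'I_n) : exists q : rat * rat,
    ratr q.1 < M ij.1 ij.2 < ratr q.2 /\
    forall x, ratr q.1 < x < ratr q.2 -> P ij.1 ij.2 x.
  have /nbhs_ballP[e /= e0 eP] := PM ij.1 ij.2.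
  set x := M _ _ in eP *.
  have /rat_in_itvoo[a] : x - e < x by rewrite ltrBlDr ltrDl.
  have /rat_in_itvoo[b] : x < x + e by rewrite ltrDl.
  rewrite !in_itv /= => /andP[xb be] /andP[ea ax].
  exists (a, b) => /=; split; first by rewrite ax xb.
  move=> y /andP[ay yb]; apply: eP; rewrite /ball /= ltr_distlC.
  by rewrite (lt_trans ea ay) (lt_trans yb be).
pose q ij := sval (cid (H ij)).
have qP ij := svalP (cid (H ij)).
exists (box (\matrix_(i, j) (q (i, j)).1, \matrix_(i, j) (q (i, j)).2)).
  split; first by eexists.
  by move=> [i j] /=; rewrite !mxE; case: (qP (i, j)).
move=> N NB; apply: PA => i j; have [_] := qP (i, j); apply.
by have := NB (i, j); rewrite /= !mxE.
Qed.

(* The maps [f i] need not be injective: over the open set [V i] each of them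
   is, and by compactness of [K] this already makes it a homeomorphism onto its
   image there. *)
Lemma manifold_of_collapses (R : realType) (K : topologicalType) (m k : nat)
    (I : countType) (f : I -> K -> 'rV[R]_m) (V : I -> set 'rV[R]_m) :
  compact [set: K] ->
  (forall i, continuous (f i)) ->
  (forall i, open (V i)) ->
  (forall x, exists i, V i (f i x)) ->
  (forall i x y, V i (f i x) -> f i x = f i y -> x = y) ->
  (forall i x, V i (f i x) -> exists (N : set 'rV[R]_m) (W : set 'rV[R]_k)
     (h : 'rV[R]_m -> 'rV[R]_k) (l : 'rV[R]_k -> 'rV[R]_m),
     [/\ open N, open W, N `<=` V i, continuous h & continuous l] /\
     [/\ N (f i x),
         forall y, N (f i y) -> W (h (f i y)) /\ l (h (f i y)) = f i y &
         forall w, W w -> [/\ N (l w), h (l w) = w &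
                              exists y, f i y = l w]]) ->
  manifold R k K.
Proof.
move=> cK cf oV covV injV chart.
(* By compactness each [f i] is a closed map; over [V i], where it is injective, this makes its
   inverse continuous. *)
have closed_image i (C : set K) : closed C -> closed (f i @` C).
  move=> cC; apply: compact_closed; first exact: norm_hausdorff.
  apply: continuous_compact; last exact: subclosed_compact cC cK _.
  exact: continuous_subspaceT.
split.
- rewrite open_hausdorff => x y /eqP xy.
  have [i Vx] := covV x.
  have : f i x != f i y by apply/eqP => /(injV i _ _ Vx).
  have := @norm_hausdorff R 'rV[R]_m; rewrite open_hausdorff => /[apply].
  move=> [[A B] /= [xA yB] [oA oB AB]].
  exists (f i @^-1` A, f i @^-1` B); rewrite /= ?inE.
    by move: xA yB; rewrite !inE.
  split; try by apply: open_comp => // z _; exact: cf.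
  by rewrite -preimage_setI (eqP AB) preimage_set0.
- have [B cB [oB nB]] := @mx_second_countable R 1 m.
  exists (\bigcup_i [set f i @^-1` b | b in B]).
    apply: bigcup_countable => // i _.
    exact: sub_countable (card_image_le _ _) cB.
  split.
    move=> _ [i _ [b Bb <-]]; apply: open_comp; last exact: oB.
    by move=> z _; exact: cf.
  move=> x A; rewrite nbhsE => -[D [oD Dx] DA].
  have [i Vx] := covV x.
  (* Values in this open set are taken inside [D] only, and [f i x] is one of them by injectivity
     over [V i]. *)
  have oC : open (~` (f i @` (~` D))).
    by rewrite openC; apply: closed_image; rewrite closedC.
  have : nbhs (f i x) (~` (f i @` (~` D))).
    apply: open_nbhs_nbhs; split=> // -[y nDy fyx].
    by apply: nDy; rewrite -(injV i x y Vx (esym fyx)).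
  move=> /nB[b [Bb bx] bO].
  exists (f i @^-1` b); first by split => //; exists i => //; exists b.
  move=> y /= /bO /= nfy; apply: DA; apply: contrapT => nDy.
  by apply: nfy; exists y.
- move=> x; have [i Vx] := covV x.
  have [N [W [h [l [[oN oW NV ch cl] [Nx hN lW]]]]]] := chart i x Vx.
  exists (f i @^-1` N), W; split=> //.
    by apply: open_comp => // z _; exact: cf.
  have phiP (u : set_type (f i @^-1` N)) : h (f i (set_val u)) \in W.
    by rewrite inE; have [] := hN (set_val u) (set_valP u).
  have psiE (w : set_type W) : exists y, f i y = l (set_val w).
    by have [] := lW _ (set_valP w).
  pose ps w := sval (cid (psiE w)).
  have psE w : f i (ps w) = l (set_val w) := svalP (cid (psiE w)).
  have psP w : ps w \in (f i @^-1` N).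
    by rewrite inE /= psE; have [] := lW _ (set_valP w).
  exists (fun u => exist (fun w => w \in W) _ (phiP u) : set_type W),
    (fun w => exist (fun y => y \in f i @^-1` N) _ (psP w) :
                set_type (f i @^-1` N)).
  split.
  + apply: set_type_continuous.
    change (continuous (h \o (f i \o (set_val : set_type (f i @^-1` N) -> K)))).
    move=> u; apply: continuous_comp; last exact: ch.
    by apply: continuous_comp; [exact: set_val_continuous|exact: cf].
  + apply: set_type_continuous; change (continuous ps).
    apply/continuousP => O oO.
    have -> : ps @^-1` O =
        (l \o (set_val : set_type W -> _)) @^-1` (~` (f i @` (~` O))).
      apply/seteqP; split => w /=.
        move=> Ow [y nOy fy]; apply: nOy.
        suff -> : y = ps w by [].
        apply: (injV i); rewrite fy -?psE //.
        by apply: NV; have := psP w; rewrite inE.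
      move=> nfw; apply: contrapT => nOw; apply: nfw.
      by exists (ps w).
    apply: open_comp; last first.
      by rewrite openC; apply: closed_image; rewrite closedC.
    move=> w _; apply: continuous_comp; first exact: set_val_continuous.
    exact: cl.
  + move=> u; apply: eq_sig_hprop => /=; first by move=> ? ? ?; exact: eq_irrelevance.
    apply: (injV i); rewrite psE /=.
      apply: NV; have [NN _ _] := lW (h (f i (set_val u))) (hN _ (set_valP u)).1.
      exact: NN.
    exact: (hN _ (set_valP u)).2.
  + move=> w; apply: eq_sig_hprop => /=; first by move=> ? ? ?; exact: eq_irrelevance.
    by rewrite psE; have [] := lW _ (set_valP w).
Qed.

(** * The realization of a gluing *)

Lemma set_type_compact (T : topologicalType) (A : set T) :
  compact A -> compact [set: set_type A].
Proof.
move=> cA; have [A0|/set0P[a0 Aa0]] := eqVneq A set0.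
  rewrite (_ : [set: set_type A] = set0); first exact: compact0.
  by apply/seteqP; split=> // -[x xA] _; exfalso; move: xA; rewrite A0 inE.
(* A retraction onto [A]; off [A] it takes the dummy value [a0], as continuity is needed on [A]
   only. *)
pose r (x : T) : set_type A :=
  if pselect (A x) is left Ax then exist (fun x => x \in A) x (mem_set Ax)
  else exist (fun x => x \in A) a0 (mem_set Aa0).
have rval u : r (set_val u) = u.
  rewrite /r; case: pselect => [Au|]; last by have := set_valP u.
  by apply: eq_sig_hprop => // *; exact: eq_irrelevance.
have -> : [set: set_type A] = r @` A.
  by apply/seteqP; split => // u _; exists (set_val u) => //; exact: set_valP.
apply: continuous_compact cA; apply/subspace_sigL_continuousP.
apply: set_type_continuous.
have -> : (fun x => set_val (sigL A r x)) = set_val.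
  by apply/funext => u; rewrite /sigL /= rval.
exact: set_val_continuous.
Qed.

Lemma sum_continuous (T : topologicalType) (R : realType) (I : finType)
    (f : I -> T -> R) :
  (forall i, continuous (f i)) -> continuous (fun x => \sum_i f i x).
Proof.
move=> cf; elim: (index_enum I) => [|i s IH].
  rewrite (_ : (fun _ => _) = cst 0); first by move=> x; exact: cvg_cst.
  by apply/funext => x; rewrite big_nil.
rewrite (_ : (fun _ => _) = (fun x => f i x + \sum_(i <- s) f i x)).
  by move=> x; apply: cvgD; [exact: cf|exact: IH].
by apply/funext => x; rewrite big_cons.
Qed.

Lemma simplex3_compact (R : realType) : compact (@simplex3 R).
Proof.
have cub : compact [set x : 'rV[R]_4 | forall i, `[0, 1]%classic (x ord0 i)].
  exact: (@rV_compact R 4 (fun=> `[0, 1]%classic) (fun _ => @segment_compact R 0 1)).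
apply: subclosed_compact cub _; last first.
  move=> x [x0 x1] i /=; rewrite in_itv /= x0 /= -x1 (bigD1 i) //=.
  by rewrite lerDl sumr_ge0.
have -> : @simplex3 R = (\bigcap_i (fun x : 'rV[R]_4 => x ord0 i) @^-1` [set y | 0 <= y])
    `&` (fun x : 'rV[R]_4 => \sum_i x ord0 i) @^-1` [set 1].
  by apply/seteqP; split => x /= [x0 x1]; split=> // i; [move=> _|]; exact: x0.
apply: closedI.
  apply: closed_bigI => i _; apply: closed_comp; last exact: closed_ge.
  by move=> x _; exact: coord_continuous.
apply: closed_comp; last exact: closed_eq.
move=> x _; apply: (@sum_continuous _ _ _ (fun i (x : 'rV[R]_4) => x ord0 i)) => i.
exact: coord_continuous.
Qed.

(** The simplex is star-shaped: the segments to vertex 0 all meet there. *)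
Lemma simplex3_connected (R : realType) :
  connected [set: set_type (@simplex3 R)].
Proof.
have e0S : (delta_mx ord0 ord0 : 'rV[R]_4) \in @simplex3 R.
  rewrite inE; split=> [i|]; first by rewrite mxE; case: (_ && _).
  rewrite (bigD1 ord0) //= mxE eqxx big1 ?addr0 // => i /negPf i0.
  by rewrite mxE i0 andbF.
(* Clamping the parameter to [0, 1] keeps [seg] inside the simplex for every real [s]. *)
pose cl (s : R) := Num.max 0 (Num.min 1 s).
have cl01 s : 0 <= cl s <= 1.
  by rewrite /cl le_max lexx /= ge_max ler01 ge_min lexx.
pose seg (x : set_type (@simplex3 R)) (s : R) : 'rV[R]_4 :=
  (1 - cl s) *: set_val x + cl s *: delta_mx ord0 ord0.
have segP x s : seg x s \in @simplex3 R.
  have [s0 s1] := andP (cl01 s); rewrite inE; have [x0 x1] := set_valP x.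
  move: e0S; rewrite inE => -[d0 d1]; split=> [i|].
    by rewrite !mxE addr_ge0 // mulr_ge0 ?subr_ge0 //; move: (d0 i); rewrite mxE.
  under eq_bigr do rewrite mxE mxE [X in _ + X]mxE.
  by rewrite big_split /= -!mulr_sumr x1 d1 !mulr1 subrK.
pose path x (s : R) : set_type (@simplex3 R) := exist (fun y => y \in @simplex3 R) _ (segP x s).
have -> : [set: set_type (@simplex3 R)] =
    \bigcup_x (path x @` `[0, 1]).
  apply/seteqP; split=> // x _; exists x => //; exists 0.
    by rewrite /= in_itv /= lexx ler01.
  apply: eq_sig_hprop => /=; first by move=> *; exact: eq_irrelevance.
  rewrite /seg /cl (_ : Num.min 1 0 = 0); last by rewrite min_r.
  by rewrite maxxx subr0 scale1r scale0r addr0.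
apply: bigcup_connected.
  exists (exist (fun y => y \in @simplex3 R) _ e0S) => x _; exists 1.
    by rewrite /= in_itv /= lexx ler01.
  apply: eq_sig_hprop => /=; first by move=> *; exact: eq_irrelevance.
  rewrite /seg /cl (_ : Num.min 1 1 = 1) ?minxx // max_r //.
  by rewrite subrr scale0r scale1r add0r.
move=> x _; apply: connected_continuous_connected; first exact: segment_connected.
apply: continuous_subspaceT; apply: set_type_continuous.
change (continuous (seg x)); apply: mx_continuous => i j.
have ccl : continuous cl.
  move=> s; apply: continuous_max; first exact: cvg_cst.
  by apply: continuous_min; [exact: cvg_cst|exact: cvg_id].
have -> : (fun s => seg x s i j) =
   (fun s => (1 - cl s) * set_val x i j + cl s * (delta_mx ord0 ord0 : 'rV[R]_4) i j).
  by apply/funext => s; rewrite /seg !mxE.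
move=> s; apply: cvgD; apply: cvgM; [|exact: cvg_cst|exact: ccl|exact: cvg_cst].
by apply: cvgB; [exact: cvg_cst|exact: ccl].
Qed.

Section Realization.
Variables (R : realType) (n : nat) (G : gluing n).
Local Open Scope quotient_scope.

Definition realization_pt (a : tetrahedra R n) : realization R G :=
  \pi_(realization R G) a.

Lemma realization_pt_surj (x : realization R G) : exists a, realization_pt a = x.
Proof. by exists (generic_quotient.repr x); rewrite /realization_pt reprK. Qed.

Lemma realization_pt_eq a b :
  clos_refl_sym_trans _ (@face_glued R n G) a b ->
  realization_pt a = realization_pt b.
Proof. by move=> ab; apply/eqmodP; apply/asboolP. Qed.

Lemma realization_pt_identified a b :
  realization_pt a = realization_pt b ->
  clos_refl_sym_trans _ (@face_glued R n G) a b.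
Proof. by move=> /eqmodP /asboolP. Qed.

Lemma realization_pt_continuous : continuous realization_pt.
Proof. exact: pi_continuous. Qed.

(** Compatibility with a single face gluing is enough, because these generate the identification. *)
Lemma realization_lift (Z : topologicalType) (g : tetrahedra R n -> Z) :
  (forall t, continuous (fun x : set_type (@simplex3 R) =>
                           g (existT (fun _ => set_type (@simplex3 R)) t x))) ->
  (forall a b, face_glued G a b -> g a = g b) ->
  exists f : realization R G -> Z,
    continuous f /\ forall a, f (realization_pt a) = g a.
Proof.
move=> cg gE.
have gE' a b : realization_pt a = realization_pt b -> g a = g b.
  move=> /realization_pt_identified; by elim=> {a b} // a b c _ -> _ ->.
exists (g \o generic_quotient.repr); split.
  apply: repr_comp_continuous.
    by move=> [t x] U nU; exact: (cg t x U nU).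
  by move=> a b /eqP ab; apply/eqP; exact: gE'.
by move=> a /=; apply: gE'; rewrite /realization_pt reprK.
Qed.

Lemma realization_compact : compact [set: realization R G].
Proof.
have -> : [set: realization R G] = realization_pt @` [set: tetrahedra R n].
  apply/seteqP; split=> // x _; have [a <-] := realization_pt_surj x.
  by exists a.
apply: continuous_compact.
  exact/continuous_subspaceT/realization_pt_continuous.
apply: sigT_compact => [|t]; first exact: finite_finset.
apply: set_type_compact; exact: simplex3_compact.
Qed.

Lemma realization_connected (t0 : 'I_n) :
  (forall t, connect (fun t t' => [exists i, (G (t, i)).1 == t']) t0 t) ->
  connected [set: realization R G].
Proof.
move=> cG.
pose A t := (realization_pt \o existT (fun _ => set_type (@simplex3 R)) t) @`
  [set: set_type (@simplex3 R)].
have cA t : connected (A t).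
  apply: connected_continuous_connected; first exact: simplex3_connected.
  apply: continuous_subspaceT => x; apply: continuous_comp.
    exact: existT_continuous.
  exact: realization_pt_continuous.
have eS (j : 'I_4) : (delta_mx ord0 j : 'rV[R]_4) \in @simplex3 R.
  rewrite inE; split=> [i|]; first by rewrite mxE; case: (_ && _).
  rewrite (bigD1 j) //= mxE !eqxx big1 ?addr0 // => i /negPf i0.
  by rewrite mxE i0 andbF.
pose e j : set_type (@simplex3 R) := exist (fun y => y \in @simplex3 R) _ (eS j).
(* Neighbouring tetrahedra share a vertex: every [j] other than [i] is a vertex of the glued
   face. *)
have meet t i : A t `&` A (G (t, i)).1 !=set0.
  pose j := lift i ord0.
  exists (realization_pt (existT (fun _ => set_type (@simplex3 R)) t (e j))); split.
    by exists (e j).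
  exists (e ((G (t, i)).2 j)) => //=; apply/esym/realization_pt_eq/rst_step.
  exists i => /=; split=> // [|k].
    by rewrite mxE eqxx /= (negPf (neq_lift _ _)).
  by rewrite !mxE !eqxx /= (inj_eq perm_inj).
have good t : exists C : set (realization R G),
    [/\ connected C, A t0 `<=` C & A t `<=` C].
  have /connectP[p] := cG t; elim/last_ind: p t => [|p u IH] t /=.
    by move=> _ ->; exists (A t0); split; first exact: cA.
  rewrite rcons_path last_rcons => /andP[pp /existsP[i /eqP Gu]] ->.
  have [C [cC C0 CL]] := IH _ pp erefl.
  exists (C `|` A u); split; [|by move=> x /C0; left|by move=> x; right].
  apply: connectedU => //.
  have [x [xl]] := meet (last t0 p) i; rewrite Gu => xu.
  by exists x; split => //; exact: CL.
pose C t := sval (cid (good t)).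
have CP t := svalP (cid (good t)).
have -> : [set: realization R G] = \bigcup_t C t.
  apply/seteqP; split=> // x _; have [[t y] <-] := realization_pt_surj x.
  by exists t => //; have [_ _] := CP t; apply; exists y.
apply: bigcup_connected; last by move=> t _; case: (CP t).
exists (realization_pt (existT (fun _ => set_type (@simplex3 R)) t0 (e ord0))) => t _.
by have [_ + _] := CP t; apply; exists (e ord0).
Qed.

End Realization.

Lemma manifold_triangulation_intro (R : realType) (n : nat) (G : gluing n) :
  face_pairing G -> manifold R 3 (realization R G) ->
  connected [set: realization R G] -> manifold_triangulation R G.
Proof.
by move=> fG mG cG; split=> //; split=> //; exact: realization_compact.
Qed.

(** * Copies of the 16-cell joined by tubes *)

(* An orthant of R^4; [true] marks the negative coordinates. *)
Definition signs : finType := {ffun 'I_4 -> bool}.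
Definition flip (j : 'I_4) (d : signs) : signs := [ffun k => d k (+) (k == j)].
Definition opp_signs (d : signs) : signs := [ffun k => ~~ d k].
Definition hot (j : 'I_4) : signs := [ffun k => k == j].
Definition no_signs : signs := [ffun=> false].
Definition mixed (d : signs) : bool := [exists k, d k] && [exists k, ~~ d k].

Lemma flipK j : involutive (flip j).
Proof. by move=> d; apply/ffunP => k; rewrite !ffunE -addbA addbb addbF. Qed.

Lemma flip_neq j d : flip j d != d.
Proof.
by apply/eqP => /ffunP /(_ j); rewrite ffunE eqxx addbT; case: (d j).
Qed.

Lemma opp_signsK : involutive opp_signs.
Proof. by move=> d; apply/ffunP => k; rewrite !ffunE negbK. Qed.

Lemma opp_flip j d : opp_signs (flip j d) = flip j (opp_signs d).
Proof. by apply/ffunP => k; rewrite !ffunE addNb. Qed.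

Lemma mixed_opp d : mixed (opp_signs d) = mixed d.
Proof.
rewrite /mixed andbC; congr (_ && _).
  by apply: eq_existsb => k; rewrite ffunE negbK.
by apply: eq_existsb => k; rewrite ffunE.
Qed.

Lemma mixed_hot j : mixed (hot j).
Proof.
apply/andP; split; apply/existsP; first by exists j; rewrite ffunE.
by exists (lift j ord0); rewrite ffunE eq_sym neq_lift.
Qed.

(** These are the pieces of a tube next to one of its two missing facets, so their face [j] lies at
    an end of the tube; the sign [d j] tells at which one. *)
Lemma not_mixed_flip j d : mixed d -> ~~ mixed (flip j d) ->
  d = if d j then hot j else opp_signs (hot j).
Proof.
move=> /andP[/existsP[a da] /existsP[b db]]; rewrite negb_and !negb_exists.
case/orP => /forallP H; apply/ffunP => k; have := H k; rewrite !ffunE.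
- have := H j; rewrite !ffunE eqxx addbT negbK => -> /=.
  by rewrite ffunE; case: (k == j); case: (d k).
- have := H j; rewrite !ffunE eqxx addbT => /negbNE/negbTE -> /=.
  by rewrite !ffunE; case: (k == j); case: (d k).
Qed.

Lemma flip_hot j : flip j (hot j) = no_signs.
Proof. by apply/ffunP => k; rewrite !ffunE addbb. Qed.

Lemma mixed_no_signs : ~~ mixed no_signs.
Proof. by rewrite negb_and negb_exists; apply/orP; left; apply/forallP => k; rewrite ffunE. Qed.

Section Design.
Variable k : nat.
(* The slot (i, b, e) is the facet e of the copy b of the 16-cell in the i-th
   pair. A facet that is neither removed nor coned is the piece
   (v, inr no_signs); the pieces (v, inl i) form the cone over the boundary of a
   coned facet, the centre taking the place of vertex i; the pieces (v, inr d)
   with d mixed form the tube that starts at the removed facet v. *)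
Definition slot : finType := ('I_k * bool * signs)%type.
Definition piece : finType := (slot * ('I_4 + signs))%type.
Variables (tubed : pred signs) (pi : signs -> {perm 'I_k}) (coned : pred slot).

Definition across (j : 'I_4) (v : slot) : slot := (v.1, flip j v.2).

Definition partner (v : slot) : slot :=
  if v.1.2 then (pi v.2 v.1.1, false, v.2)
  else ((pi v.2)^-1%g v.1.1, true, v.2).

(* The tube belongs to the slots at both of its ends, which see it with
   opposite signs. *)
Definition tube_piece (v : slot) (d : signs) : piece :=
  if v.1.2 then (v, inr d) else (partner v, inr (opp_signs d)).

(** The piece at slot [v] whose face [j] is the triangle of the facet [v] opposite vertex [j],
    whatever fills the slot. *)
Definition outer_piece (v : slot) (j : 'I_4) : piece :=
  if tubed v.2 then tube_piece v (hot j)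
  else if coned v then (v, inl j) else (v, inr no_signs).

Definition valid_piece (t : piece) : bool :=
  match t.2 with
  | inl _ => ~~ tubed t.1.2 && coned t.1
  | inr d => if tubed t.1.2 then t.1.1.2 && mixed d
             else ~~ coned t.1 && (d == no_signs)
  end.

(** Between two pieces of a cone the centre moves from position [i] to position [j], hence the
    transposition; every other gluing keeps the vertex numbers. *)
Definition glue_piece (t : piece) (j : 'I_4) : piece * {perm 'I_4} :=
  match t.2 with
  | inl i => if i == j then (outer_piece (across j t.1) j, 1%g)
             else ((t.1, inl j), tperm i j)
  | inr d =>
      if tubed t.1.2 then
        if mixed (flip j d) then ((t.1, inr (flip j d)), 1%g)
        else (outer_piece (across j (if d j then t.1 else partner t.1)) j, 1%g)
      else (outer_piece (across j t.1) j, 1%g)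
  end.

Lemma partner_signs v : (partner v).2 = v.2.
Proof. by rewrite /partner; case: ifP. Qed.

Lemma partner_side v : (partner v).1.2 = ~~ v.1.2.
Proof. by rewrite /partner; case: v => [[i []] e]. Qed.

Lemma partnerK : involutive partner.
Proof.
by move=> [[i []] e]; rewrite /partner /= ?permK ?permKV.
Qed.

Lemma acrossK j : involutive (across j).
Proof. by move=> [c e]; rewrite /across /= flipK. Qed.

Lemma valid_tube v d : tubed v.2 -> mixed d -> valid_piece (tube_piece v d).
Proof.
move=> Tv md; rewrite /tube_piece /valid_piece; case: ifP => /= s.
  by rewrite Tv s md.
by rewrite partner_signs Tv partner_side s mixed_opp.
Qed.

Lemma valid_outer v j : valid_piece (outer_piece v j).
Proof.
rewrite /outer_piece; case: ifP => Tv; first exact/valid_tube/mixed_hot.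
by case: ifP => Cv; rewrite /valid_piece /= Tv ?Cv ?eqxx.
Qed.

Lemma outer_signs v j : (outer_piece v j).1.2 = v.2.
Proof.
rewrite /outer_piece /tube_piece; case: ifP => _; case: ifP => //= _.
exact: partner_signs.
Qed.

Lemma glue_tube v d j : tubed v.2 -> mixed d ->
  glue_piece (tube_piece v d) j =
    if mixed (flip j d) then (tube_piece v (flip j d), 1%g)
    else (outer_piece (across j (if d j then v else partner v)) j, 1%g).
Proof.
move=> Tv md; rewrite /tube_piece /glue_piece; case: ifP => /= s; first by rewrite Tv.
rewrite partner_signs Tv -opp_flip mixed_opp partnerK ffunE.
by case: ifP => // _; case: (d j).
Qed.

Lemma glue_outer v j : glue_piece (outer_piece v j) j = (outer_piece (across j v) j, 1%g).
Proof.
rewrite {1}/outer_piece; case: ifP => Tv.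
  rewrite glue_tube ?mixed_hot // flip_hot (negPf mixed_no_signs).
  by rewrite ffunE eqxx.
by case: ifP => Cv; rewrite /glue_piece /= ?eqxx ?Tv.
Qed.

(** A face lies on the boundary of a slot, or between two pieces of a cone, or between two pieces of
    a tube. All later arguments on faces split in this way. *)
Lemma glue_cases t j : valid_piece t ->
  [\/ exists v, t = outer_piece v j,
      exists v i, [/\ t = (v, inl i), i != j, ~~ tubed v.2, coned v &
                      glue_piece t j = ((v, inl j), tperm i j)] |
      exists v d, [/\ t = (v, inr d), tubed v.2, mixed d, mixed (flip j d) &
                      glue_piece t j = ((v, inr (flip j d)), 1%g)] ].
Proof.
case: t => v [i|d]; rewrite /valid_piece /= => V.
  have [/negPf Tv Cv] := andP V.
  have [ij|ij] := eqVneq i j; last first.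
    by apply: Or32; exists v, i; rewrite /glue_piece /= (negPf ij) Tv.
  by apply: Or31; exists v; rewrite /outer_piece Tv Cv ij.
case: ifP V => Tv; last first.
  move=> /andP[/negPf Cv /eqP ->]; apply: Or31; exists v.
  by rewrite /outer_piece Tv Cv.
move=> /andP[sv md]; have [mf|mf] := boolP (mixed (flip j d)).
  by apply: Or33; exists v, d; rewrite /glue_piece /= Tv mf.
apply: Or31; have /esym dE := not_mixed_flip md mf.
have [dj|dj] := boolP (d j).
  by exists v; rewrite /outer_piece Tv /tube_piece sv -dE dj.
exists (partner v); rewrite /outer_piece partner_signs Tv /tube_piece partner_side sv /=.
by rewrite partnerK -dE (negPf dj).
Qed.

Lemma valid_glue t j : valid_piece t -> valid_piece (glue_piece t j).1.
Proof.
move=> V; case: (glue_cases j V) => [[v ->]|[v [i [-> ij Tv Cv ->]]]|[v [d [E Tv md mf ->]]]].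
- by rewrite glue_outer /=; exact: valid_outer.
- by rewrite /valid_piece /= Tv.
- by move: V; rewrite E /valid_piece /= Tv mf => /andP[-> _].
Qed.

Lemma glue_neq t j : valid_piece t -> ((glue_piece t j).1, (glue_piece t j).2 j) != (t, j).
Proof.
move=> V; case: (glue_cases j V) => [[v ->]|[v [i [-> ij Tv Cv ->]]]|[v [d [-> Tv md mf ->]]]].
- rewrite glue_outer /=; apply/eqP => -[/(congr1 (fun t : piece => t.1.2))].
  by rewrite !outer_signs /= => /eqP; rewrite (negPf (flip_neq _ _)).
- by rewrite tpermR /=; apply/eqP => -[_] ji; rewrite ji eqxx in ij.
- by apply/eqP => -[fd _]; move: (flip_neq j d); rewrite fd eqxx.
Qed.

Lemma glueK t j : valid_piece t ->
  glue_piece (glue_piece t j).1 ((glue_piece t j).2 j) = (t, (glue_piece t j).2^-1%g).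
Proof.
move=> V; case: (glue_cases j V) => [[v ->]|[v [i [-> ij Tv Cv ->]]]|[v [d [-> Tv md mf ->]]]].
- by rewrite !glue_outer /= perm1 glue_outer acrossK invg1.
- by rewrite /= tpermR /glue_piece /= eq_sym (negPf ij) tpermC tpermV.
- by rewrite /= perm1 invg1 /glue_piece /= Tv flipK md.
Qed.

End Design.

(** * Turning the outside of a facet into the facet *)

Section Inversion.
Variable R : realType.
Implicit Types (z q : 'I_4 -> R) (c a : R).

(* [invert] carries the outside {min z <= 0} of the positive facet of the
   sphere |z|_1 = 1 into that facet, fixing their common boundary, and then
   shrinks to 0 what lies beyond {4 * pos_sum z = 1}. The image of this far part
   before the shrinking is [core]. *)
Definition min4 z : R := \big[Num.min/z ord0]_k z k.
Definition l1norm z : R := \sum_k `|z k|.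
Definition pos_sum z : R := \sum_k Num.max 0 (z k).
Definition lift4 z : 'I_4 -> R := fun k => z k - 2 * Num.min 0 (min4 z).
Definition invert z : 'I_4 -> R :=
  fun k => Num.min 1 (4 * pos_sum z) / (\sum_j lift4 z j) * lift4 z k.
Definition unlift4 q : 'I_4 -> R := fun k => `|q k| - 2 * min4 (fun j => `|q j|).
Definition core q : Prop := 4 * pos_sum (unlift4 q) <= l1norm (unlift4 q).

Lemma min4_le z k : min4 z <= z k.
Proof. exact: bigmin_le_cond. Qed.

Lemma min4_ex z : exists k, z k = min4 z.
Proof.
rewrite /min4; elim/big_ind : _ => [|x y [i <-] [j <-]|i _]; last by exists i.
  by exists ord0.
by have [_|_] := leP (z i) (z j); [exists i|exists j].
Qed.

Lemma min4_eq z a : (forall k, a <= z k) -> (exists k, z k = a) -> min4 z = a.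
Proof.
move=> az [k zk]; apply/le_anti; rewrite -{1}zk min4_le /=.
by have [j <-] := min4_ex z.
Qed.

Lemma min4_affine z c a : 0 <= c ->
  min4 (fun k => c * z k + a) = c * min4 z + a.
Proof.
move=> c0; apply: min4_eq => [k|]; first by rewrite lerD2r ler_wpM2l ?min4_le.
by have [k <-] := min4_ex z; exists k.
Qed.

Lemma l1norm_ge0 z : 0 <= l1norm z.
Proof. by apply: sumr_ge0. Qed.

Lemma l1norm_0 z : l1norm z = 0 -> forall k, z k = 0.
Proof.
move=> /eqP; rewrite psumr_eq0 // => /allP H k.
by have := H k (mem_index_enum _); rewrite /= normr_eq0 => /eqP.
Qed.

Lemma l1normZ z c : 0 <= c -> l1norm (fun k => c * z k) = c * l1norm z.
Proof.
by move=> c0; rewrite /l1norm mulr_sumr; apply: eq_bigr => k _; rewrite normrM ger0_norm.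
Qed.

Lemma pos_sumZ z c : 0 <= c -> pos_sum (fun k => c * z k) = c * pos_sum z.
Proof.
move=> c0; rewrite /pos_sum mulr_sumr; apply: eq_bigr => k _.
by rewrite maxr_pMr // mulr0.
Qed.

Lemma pos_sum_ge0 z : 0 <= pos_sum z.
Proof. by apply: sumr_ge0 => k _; rewrite le_max lexx. Qed.

Lemma pos_sum_id z : (forall k, 0 <= z k) -> pos_sum z = \sum_k z k.
Proof. by move=> z0; apply: eq_bigr => k _; rewrite max_r. Qed.

Lemma pos_sum_neg z : pos_sum z + pos_sum (fun k => - z k) = l1norm z.
Proof.
rewrite /pos_sum -big_split; apply: eq_bigr => k _ /=.
have [z0|z0] := leP 0 (z k).
  by rewrite max_l ?oppr_le0 // addr0 ger0_norm.
by rewrite max_r ?oppr_ge0 ?ltW // add0r ltr0_norm.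
Qed.

Lemma l1norm_id z : (forall k, 0 <= z k) -> l1norm z = \sum_k z k.
Proof. by move=> z0; apply: eq_bigr => k _; rewrite ger0_norm. Qed.

Lemma lift4_ge0 z k : 0 <= lift4 z k.
Proof.
rewrite /lift4; have := min4_le z k.
have [m0|m0] := leP 0 (min4 z); lra.
Qed.

Lemma sum_lift4_gt0 z : l1norm z = 1 -> 0 < \sum_k lift4 z k.
Proof.
move=> z1; rewrite lt_def sumr_ge0 ?andbT => [|k _]; last exact: lift4_ge0.
rewrite psumr_eq0 => [|k _]; last exact: lift4_ge0.
apply/negP => /allP H.
have H' k : lift4 z k = 0 by apply/eqP/H; rewrite mem_index_enum.
have [k zk] := min4_ex z.
have m0 : min4 z = 0.
  by have := H' k; rewrite /lift4 zk; have [|] := leP 0 (min4 z); lra.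
suff : l1norm z = 0 by rewrite z1 => /eqP; rewrite oner_eq0.
rewrite /l1norm big1 // => j _; apply/normr0P/eqP.
by have := H' j; rewrite /lift4 m0 minxx mulr0 subr0.
Qed.

Lemma invert_ge0 z k : 0 <= invert z k.
Proof.
rewrite /invert mulr_ge0 ?lift4_ge0 // divr_ge0 //.
  by rewrite le_min ler01 mulr_ge0 // pos_sum_ge0.
by apply: sumr_ge0 => j _; exact: lift4_ge0.
Qed.

Lemma invert_id z : (forall k, 0 <= z k) -> \sum_k z k = 1 -> invert z = z.
Proof.
move=> z0 z1.
have lz : lift4 z = z.
  apply/funext => k; rewrite /lift4 min_l ?mulr0 ?subr0 //.
  by have [j <-] := min4_ex z.
apply/funext => k; rewrite /invert lz z1 pos_sum_id // z1 mulr1 invr1 mulr1 min_l ?mul1r //.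
by rewrite ler1n.
Qed.

Lemma invert_neg z : (forall k, z k <= 0) -> invert z = fun=> 0.
Proof.
move=> z0; apply/funext => k; rewrite /invert (_ : pos_sum z = 0).
  by rewrite mulr0 min_r ?mul0r.
by rewrite /pos_sum big1 // => j _; rewrite max_l.
Qed.

(** A minimum m <= 0 becomes -m under [lift4], so subtracting twice the new minimum restores [z];
    scaling commutes with both operations. *)
Lemma unlift_lift4 z c : 0 <= c -> min4 z <= 0 ->
  unlift4 (fun k => c * lift4 z k) = fun k => c * z k.
Proof.
move=> c0 m0.
have E k : `|c * lift4 z k| = c * z k + c * - 2 * min4 z.
  rewrite ger0_norm ?mulr_ge0 ?lift4_ge0 // /lift4 min_r //; ring.
apply/funext => k; rewrite /unlift4 (_ : (fun j => _) = fun j => c * z j + c * - 2 * min4 z).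
  by rewrite min4_affine // E; ring.
by apply/funext => j; exact: E.
Qed.

(** Off the core the shrinking factor is 1, so [invert] merely lifts and rescales to sum 1.
    Unlifting and rescaling to norm 1 undoes this. *)
Lemma invertP z : l1norm z = 1 -> min4 z <= 0 -> ~ core (invert z) ->
  [/\ 1 < 4 * pos_sum z, \sum_k invert z k = 1 &
      z = fun k => unlift4 (invert z) k / l1norm (unlift4 (invert z))].
Proof.
move=> z1 m0; rewrite /core; set c := Num.min 1 (4 * pos_sum z) / (\sum_j lift4 z j).
have s0 := sum_lift4_gt0 z1.
have c0 : 0 <= c.
  by apply: divr_ge0; [rewrite le_min ler01 mulr_ge0 ?pos_sum_ge0|exact: ltW].
have -> : invert z = fun k => c * lift4 z k by [].
rewrite unlift_lift4 // l1normZ // pos_sumZ // z1 => H.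
have {}c0 : 0 < c.
  rewrite lt_def c0 andbT; apply/eqP => cE; apply: H.
  by rewrite cE !mul0r mulr0.
have P1 : 1 < 4 * pos_sum z.
  by rewrite ltNge; apply/negP => H'; apply: H; rewrite mulrCA ler_pM2l.
split=> //.
  by rewrite -mulr_sumr /c min_l ?ltW // mul1r mulVf // gt_eqF.
by apply/funext => k; rewrite mulr1 mulrAC mulfV ?mul1r // gt_eqF.
Qed.

Lemma invert_notcore z : l1norm z = 1 -> min4 z <= 0 -> 1 < 4 * pos_sum z ->
  ~ core (invert z).
Proof.
move=> z1 m0 P1; rewrite /core; set c := Num.min 1 (4 * pos_sum z) / (\sum_j lift4 z j).
have c0 : 0 < c.
  by rewrite divr_gt0 ?sum_lift4_gt0 // lt_min ltr01 (lt_trans ltr01).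
have -> : invert z = fun k => c * lift4 z k by [].
have c0' := ltW c0; rewrite unlift_lift4 // l1normZ // pos_sumZ // z1.
by rewrite mulrCA ler_pM2l // leNgt P1.
Qed.

(** The same [core] serves the facets of all orthants. *)
Lemma core_abs q q' : (forall k, `|q k| = `|q' k|) -> core q -> core q'.
Proof.
move=> qq; rewrite /core (_ : unlift4 q = unlift4 q') //.
by apply/funext => k; rewrite /unlift4 qq; congr (_ - 2 * min4 _); apply/funext.
Qed.

(** With a zero coordinate, [unlift4 q] is just |q|; its positive part is its whole norm, and 4 <= 1
    fails. *)
Lemma not_core_boundary q j : l1norm q = 1 -> q j = 0 -> ~ core q.
Proof.
move=> q1 qj.
have m0 : min4 (fun k => `|q k|) = 0.
  by apply: min4_eq => //; exists j; rewrite qj normr0.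
have -> : core q = core (fun k => `|q k|).
  by rewrite propeqE; split; apply: core_abs => k; rewrite normr_id.
rewrite /core (_ : unlift4 _ = fun k => `|q k|); last first.
  apply/funext => k; rewrite /unlift4 (_ : (fun j0 => _) = fun k => `|q k|).
    by rewrite m0 mulr0 subr0 normr_id.
  by apply/funext => i; rewrite normr_id.
rewrite pos_sum_id // l1norm_id // -/(l1norm q) q1; apply/negP; rewrite -ltNge; lra.
Qed.

(** The point [z] is [unlift4 q] rescaled to norm 1. The last conclusion is for [chart_surj]: a
    nonnegative [z] has no mixed signs of its own, but a zero coordinate lets it be placed in a tube
    all the same. *)
Lemma invert_surj q : (forall k, 0 <= q k) -> \sum_k q k = 1 -> ~ core q ->
  exists z, [/\ l1norm z = 1, min4 z <= 0, 1 < 4 * pos_sum z, invert z = q &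
             (forall k, 0 <= z k) -> exists k, q k = 0].
Proof.
move=> q0 q1 nq; pose u := unlift4 q; pose N := l1norm u.
have uE k : u k = q k - 2 * min4 q.
  rewrite /u /unlift4 ger0_norm // (_ : (fun j => _) = q) //.
  by apply/funext => j; rewrite ger0_norm.
have N0 : 0 < N.
  rewrite lt_def l1norm_ge0 andbT; apply/eqP => N0; apply: nq.
  rewrite /core -/u -/N N0 /pos_sum big1 ?mulr0 // => k _.
  by rewrite (l1norm_0 N0) maxxx.
have Ni : 0 <= N^-1 by rewrite invr_ge0 ltW.
pose z k := N^-1 * u k.
have mq : 0 <= min4 q by have [j <-] := min4_ex q.
have mz : min4 z = - (N^-1 * min4 q).
  have -> : z = fun k => N^-1 * q k + N^-1 * (- 2 * min4 q).
    by apply/funext => k; rewrite /z uE; ring.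
  by rewrite min4_affine //; ring.
have z1 : l1norm z = 1 by rewrite l1normZ // mulVf ?gt_eqF.
have mz0 : min4 z <= 0 by rewrite mz oppr_le0 mulr_ge0.
have P1 : 1 < 4 * pos_sum z.
  by rewrite pos_sumZ // mulrCA ltr_pdivlMl // mulr1 ltNge; apply/negP.
exists z; split=> //.
- have lz : lift4 z = fun k => N^-1 * q k.
    by apply/funext => k; rewrite /lift4 min_r // mz /z uE; ring.
  apply/funext => k; rewrite /invert lz -mulr_sumr q1 mulr1 min_l ?ltW // invrK.
  by rewrite mul1r mulrA mulfV ?mul1r // gt_eqF.
- move=> z0; have [k qk] := min4_ex q; exists k; rewrite qk; apply/eqP.
  have := z0 k; rewrite /z uE qk => H; rewrite eq_le mq andbT.
  have : 0 <= N * (N^-1 * (min4 q - 2 * min4 q)) by rewrite mulr_ge0 // ltW.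
  by rewrite mulrA mulfV ?gt_eqF // mul1r; lra.
Qed.

End Inversion.

Section InversionContinuity.
Variables (R : realType) (T : topologicalType) (z : T -> 'I_4 -> R).
Hypothesis cz : forall k, continuous (fun x => z x k).

Lemma min4_continuous : continuous (fun x => min4 (z x)).
Proof.
rewrite /min4; elim: (index_enum _) => [|i s IH].
  rewrite (_ : (fun x => _) = fun x => z x ord0); first exact: cz.
  by apply/funext => x; rewrite big_nil.
rewrite (_ : (fun x => _) = (fun x => Num.min (z x i)
    (\big[Num.min/z x ord0]_(j <- s) z x j))).
  by move=> x; apply: continuous_min; [exact: cz|exact: IH].
by apply/funext => x; rewrite big_cons.
Qed.

Lemma l1norm_continuous : continuous (fun x => l1norm (z x)).
Proof.
apply: sum_continuous => k x.
by apply: continuous_comp; [exact: cz|exact: norm_continuous].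
Qed.

Lemma pos_sum_continuous : continuous (fun x => pos_sum (z x)).
Proof.
by apply: sum_continuous => k x; apply: continuous_max; [exact: cvg_cst|exact: cz].
Qed.

Lemma lift4_continuous k : continuous (fun x => lift4 (z x) k).
Proof.
move=> x; apply: cvgB; first exact: cz.
apply: cvgM; first exact: cvg_cst.
by apply: continuous_min; [exact: cvg_cst|exact: min4_continuous].
Qed.

Lemma invert_continuous k :
  (forall x, l1norm (z x) = 1) -> continuous (fun x => invert (z x) k).
Proof.
move=> z1 x; apply: cvgM; last exact: lift4_continuous.
apply: cvgM; last first.
  apply: cvgV; first by rewrite gt_eqF // sum_lift4_gt0.
  by apply: sum_continuous => j; exact: lift4_continuous.
have : continuous (fun x => Num.min 1 (4 * pos_sum (z x))).
  move=> y; apply: (@continuous_min _ _ (fun=> 1) (fun x => 4 * pos_sum (z x))).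
    exact: cvg_cst.
  by apply: cvgM; [exact: cvg_cst|exact: pos_sum_continuous].
exact.
Qed.
End InversionContinuity.

Lemma unlift_continuous (R : realType) (T : topologicalType)
    (z : T -> 'I_4 -> R) k :
  (forall k, continuous (fun x => z x k)) ->
  continuous (fun x => unlift4 (z x) k).
Proof.
move=> cz; have cn j : continuous (fun x => `|z x j|).
  by move=> x; apply: continuous_comp; [exact: cz|exact: norm_continuous].
move=> x; apply: cvgB; first exact: (cn k x).
by apply: cvgM; [exact: cvg_cst|exact: (min4_continuous cn)].
Qed.

Lemma core_closed (R : realType) (T : topologicalType) (z : T -> 'I_4 -> R) :
  (forall k, continuous (fun x => z x k)) -> closed [set x | core (z x)].
Proof.
move=> cz; have cu k : continuous (fun x => unlift4 (z x) k).
  exact: unlift_continuous.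
have -> : [set x | core (z x)] =
  (fun x => l1norm (unlift4 (z x)) - 4 * pos_sum (unlift4 (z x))) @^-1` [set y | 0 <= y].
  by apply/seteqP; split => p /=; rewrite subr_ge0.
apply: closed_comp; last exact: closed_ge.
move=> p _; apply: cvgB; first exact: (l1norm_continuous cu).
by apply: cvgM; [exact: cvg_cst|exact: (pos_sum_continuous cu)].
Qed.

(** * Collapsing maps to R^4 *)

Section Coordinates.
Variable R : realType.
Implicit Types (y z : 'I_4 -> R) (d e : signs).

Definition sgv e z : 'I_4 -> R := fun k => (-1) ^+ (e k) * z k.
Definition in_simplex y := (forall k, 0 <= y k) /\ \sum_k y k = 1.
Definition bary (y : set_type (@simplex3 R)) : 'I_4 -> R :=
  fun k => set_val y ord0 k.

Lemma baryP (x : set_type (@simplex3 R)) : in_simplex (bary x).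
Proof. by have [] := set_valP x. Qed.

Lemma bary_inj : injective bary.
Proof.
move=> x y xy; apply: eq_sig_hprop => /=; first by move=> *; exact: eq_irrelevance.
by apply/rowP => k; exact: (congr1 (fun f => f k) xy).
Qed.

Lemma bary_surj y : in_simplex y -> exists x, bary x = y.
Proof.
move=> [y0 y1]; have yS : (\row_k y k) \in @simplex3 R.
  rewrite inE; split=> [k|]; first by rewrite mxE.
  by under eq_bigr do rewrite mxE.
exists (exist (fun x => x \in @simplex3 R) _ yS).
by apply/funext => k; rewrite /bary /= mxE.
Qed.

Lemma sgv_abs e z k : `|sgv e z k| = `|z k|.
Proof. by rewrite /sgv normrMsign. Qed.

Lemma sgvK e z : sgv e (sgv e z) = z.
Proof. by apply/funext => k; rewrite /sgv signrMK. Qed.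

Lemma sgv_neg d z : sgv (opp_signs d) z = fun k => - sgv d z k.
Proof. by apply/funext => k; rewrite /sgv ffunE signrN mulNr. Qed.

Lemma l1norm_sgv e z : l1norm (sgv e z) = l1norm z.
Proof. by apply: eq_bigr => k _; exact: sgv_abs. Qed.

Lemma l1normN z : l1norm (fun k => - z k) = l1norm z.
Proof. by apply: eq_bigr => k _; rewrite normrN. Qed.

Lemma l1norm_simplex y : in_simplex y -> l1norm y = 1.
Proof. by move=> [y0 y1]; rewrite l1norm_id. Qed.

Lemma sgv0 e : sgv e (fun=> 0) = fun=> 0.
Proof. by apply/funext => k; rewrite /sgv mulr0. Qed.

Lemma min4_mixed d y : mixed d -> (forall k, 0 <= y k) -> min4 (sgv d y) <= 0.
Proof.
move=> /andP[/existsP[k dk] _] y0; apply: le_trans (min4_le _ k) _.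
by rewrite /sgv dk expr1 mulN1r oppr_le0.
Qed.

(** A piece of a cone has its vertex [i], the centre, at the barycentre (1/4, 1/4, 1/4, 1/4) of the
    facet. *)
Definition zcoord (q : 'I_4 + signs) y : 'I_4 -> R :=
  match q with
  | inl i => fun k => (k != i)%:R * y k + y i / 4
  | inr d => sgv d y
  end.

Lemma coord_cone_ge0 i y k : in_simplex y -> 0 <= zcoord (inl i) y k.
Proof.
by move=> [y0 _] /=; rewrite addr_ge0 ?mulr_ge0 ?ler0n.
Qed.

Lemma coord_cone_sum i y : in_simplex y -> \sum_k zcoord (inl i) y k = 1.
Proof.
move=> [y0 y1] /=; rewrite big_split /= sumr_const card_ord.
rewrite -[RHS]y1 (bigD1 i) //= [in RHS](bigD1 i) //= eqxx mul0r add0r.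
have -> : y i / 4 *+ 4 = y i by lra.
rewrite addrC; congr (_ + _).
by apply: eq_bigr => j ->; rewrite mul1r.
Qed.

Lemma l1norm_coord q y : in_simplex y -> l1norm (zcoord q y) = 1.
Proof.
case: q => [i|d] ys; last by rewrite /= l1norm_sgv l1norm_simplex.
rewrite l1norm_id ?coord_cone_sum // => k; exact: coord_cone_ge0.
Qed.

(** Comparing coordinates [i] and [j] gives y j + y' i = 0, so both vanish: the point is on the
    common face of the two pieces. *)
Lemma coord_cone_swap i j y y' : i != j -> in_simplex y -> in_simplex y' ->
  zcoord (inl i) y = zcoord (inl j) y' ->
  y j = 0 /\ forall k, y' (tperm i j k) = y k.
Proof.
move=> ij [y0 _] [y'0 _] E.
have Ei : y i / 4 = y' i + y' j / 4.
  by have := congr1 (fun f => f i) E; rewrite /= eqxx ij mul0r add0r mul1r.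
have Ej : y j + y i / 4 = y' j / 4.
  have := congr1 (fun f => f j) E; rewrite /= eqxx eq_sym ij mul0r add0r mul1r.
  by [].
have yj := y0 j; have y'i := y'0 i.
split=> [|k]; first by lra.
case: tpermP => [->|->|/eqP ki /eqP kj]; [by lra|by lra|].
have := congr1 (fun f => f k) E; rewrite /= ki kj !mul1r; lra.
Qed.

Lemma coord_cone_inj i y y' : zcoord (inl i) y = zcoord (inl i) y' -> y = y'.
Proof.
move=> E; have Ei : y i = y' i.
  by have := congr1 (fun f => f i) E; rewrite /= eqxx !mul0r !add0r; lra.
apply/funext => k; have [->//|ki] := eqVneq k i.
by have := congr1 (fun f => f k) E; rewrite /= ki !mul1r Ei => /addIr.
Qed.

Lemma coord_cone_glue i j y y' : i != j -> y j = 0 ->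
  (forall k, y' (tperm i j k) = y k) -> zcoord (inl j) y' = zcoord (inl i) y.
Proof.
move=> ij yj yy'; have y'j : y' j = y i by rewrite -yy' tpermL.
have y'i : y' i = 0 by rewrite -yj -yy' tpermR.
apply/funext => k /=; rewrite y'j.
have [->|ki] := eqVneq k i; first by rewrite ij y'i mulr0 mul0r.
have [->|kj] := eqVneq k j; first by rewrite yj mulr0 mul0r.
by rewrite -(yy' k) tpermD // eq_sym.
Qed.

(** A smallest coordinate q i can be split off from all four coordinates; it becomes the weight 4 *
    q i of the centre. *)
Lemma coord_cone_surj q : in_simplex q ->
  exists i y, in_simplex y /\ zcoord (inl i) y = q.
Proof.
move=> [q0 q1]; have [i qi] := min4_ex q.
pose y k := if k == i then 4 * q i else q k - q i.
have E : zcoord (inl i) y = q.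
  apply/funext => k /=; rewrite /y eqxx.
  by have [->|ki] := eqVneq k i; rewrite ?mul0r ?mul1r ?add0r; lra.
exists i, y; split=> //; split=> [k|].
  rewrite /y; case: eqP => _; first by rewrite mulr_ge0.
  by rewrite subr_ge0 qi min4_le.
rewrite -[RHS]q1 -E /= big_split /= sumr_const card_ord.
rewrite (bigD1 i) //= [in RHS](bigD1 i) //= eqxx mul0r add0r.
have -> : y i / 4 *+ 4 = y i by lra.
rewrite addrC; congr (_ + _).
by apply: eq_bigr => j ->; rewrite mul1r.
Qed.

Lemma coord_tube_glue j d y : y j = 0 -> zcoord (inr (flip j d)) y = zcoord (inr d) y.
Proof.
move=> yj; apply/funext => k /=; rewrite /sgv ffunE.
by have [->|] := eqVneq k j; rewrite ?yj ?mulr0 // addbF.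
Qed.

Section Collapse.
Variables (n : nat) (tubed : pred signs) (pi : signs -> {perm 'I_n}).
Variable coned : pred (slot n).
Local Notation partner := (partner pi).
Local Notation valid := (valid_piece tubed coned).
Local Notation outer_piece := (outer_piece tubed pi coned).
Local Notation glue_piece := (glue_piece tubed pi coned).
Implicit Types (v : slot n) (t : piece n) (c : 'I_n * bool).

(** The two ends of a tube never belong to the same copy, since partners lie on different sides.
    Pieces away from copy [c] get the value 0 that [invert] takes at the far end of a tube. *)
Definition collapse c t y : 'I_4 -> R :=
  if t.1.1 == c then sgv t.1.2 (invert (zcoord t.2 y))
  else if tubed t.1.2 && ((partner t.1).1 == c) then
    sgv t.1.2 (invert (fun k => - zcoord t.2 y k))
  else fun=> 0.

(* A tube is seen from both of its ends; from the far end its coordinates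
   change sign. *)
Definition sees v t y z : Prop :=
  t.1 = v /\ z = zcoord t.2 y \/
  [/\ tubed v.2, partner t.1 = v & z = fun k => - zcoord t.2 y k].

Lemma collapse_sees v t y z : sees v t y z -> collapse v.1 t y = sgv v.2 (invert z).
Proof.
case=> [[<- ->]|[Tv tv ->]]; first by rewrite /collapse eqxx.
move: Tv; rewrite -tv /collapse eqxx partner_signs => ->.
case: ifP => // /eqP /(congr1 snd); rewrite partner_side.
by case: (t.1.1.2).
Qed.

Lemma sees_collapse c t y k : collapse c t y k != 0 ->
  exists e z, sees (c, e) t y z.
Proof.
rewrite /collapse; case: ifP => [/eqP tc _|_].
  exists t.1.2, (zcoord t.2 y); left; split=> //.
  by rewrite -tc; case: (t.1).
case: ifP => [/andP[Tt /eqP tc] _|]; last by rewrite eqxx.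
exists t.1.2, (fun k => - zcoord t.2 y k); right; split=> //.
by rewrite -tc -(partner_signs pi t.1); case: (partner t.1).
Qed.

Lemma sees_l1norm v t y z : in_simplex y -> sees v t y z -> l1norm z = 1.
Proof. by move=> ys [[_ ->]|[_ _ ->]]; rewrite ?l1normN l1norm_coord. Qed.

Lemma sees_untubed v t y z : ~~ tubed v.2 -> valid t -> in_simplex y ->
  sees v t y z -> in_simplex z.
Proof.
move=> Tv V ys [[tv ->]|[]]; last by rewrite (negPf Tv).
move: V; rewrite /valid tv (negPf Tv) /=; case: (t.2) => [i _|d].
  by split=> [k|]; [exact: coord_cone_ge0|exact: coord_cone_sum].
move=> /andP[_ /eqP ->]; rewrite (_ : zcoord _ _ = y) //.
by apply/funext => k; rewrite /= /sgv ffunE mul1r.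
Qed.

Lemma sees_tube v t y z : tubed v.2 -> valid t -> sees v t y z ->
  exists d, [/\ mixed d, t = tube_piece pi v d & z = sgv d y].
Proof.
move=> Tv V [[tv ->]|[_ tv ->]].
  move: V; rewrite /valid tv Tv /=; case tE : (t.2) => [//|d] /andP[sv md].
  by exists d; split=> //; rewrite /tube_piece sv -tv -tE; case: (t).
have tv2 : t.1.2 = v.2 by rewrite -tv partner_signs.
move: V; rewrite /valid tv2 Tv /=; case tE : (t.2) => [//|d] /andP[sv md].
exists (opp_signs d); split; [by rewrite mixed_opp| |by rewrite sgv_neg].
by rewrite /tube_piece -tv partner_side sv /= partnerK opp_signsK -tE; case: (t).
Qed.

Lemma tube_sees v d y : tubed v.2 -> sees v (tube_piece pi v d) y (sgv d y).
Proof.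
move=> Tv; rewrite /tube_piece; case: ifP => _; first by left.
right; split=> //; first by rewrite /= partnerK.
by rewrite /= -sgv_neg opp_signsK.
Qed.

Lemma sees_min4 v t y z : tubed v.2 -> valid t -> in_simplex y ->
  sees v t y z -> min4 z <= 0.
Proof.
move=> Tv V [y0 _] /(sees_tube Tv V)[d [md _ ->]]; exact: min4_mixed.
Qed.


Lemma sees_outer v j y : y j = 0 -> sees v (outer_piece v j) y y.
Proof.
move=> yj; have E d : (forall k, d k -> k = j) -> sgv d y = y.
  move=> dj; apply/funext => k; rewrite /sgv.
  by case dk : (d k); rewrite ?mul1r // (dj k dk) yj mulr0.
rewrite /outer_piece; case: ifP => Tv.
  have := @tube_sees v (hot j) y Tv; rewrite (E (hot j)) // => k.
  by rewrite ffunE => /eqP.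
case: ifP => _; left; split=> //=.
  apply/funext => k; rewrite yj mul0r addr0.
  by have [->|] := eqVneq k j; rewrite ?yj ?mulr0 ?mul1r.
by rewrite E // => k; rewrite ffunE.
Qed.

(** From its own slot a boundary triangle has nonnegative coordinates, which [invert] fixes; from
    the far end of the tube they are nonpositive, and [invert] sends them to 0. So the value does
    not depend on what fills the slot. *)
Lemma collapse_outer c v j y : y j = 0 -> in_simplex y ->
  collapse c (outer_piece v j) y = if v.1 == c then sgv v.2 y else fun=> 0.
Proof.
move=> yj [y0 y1]; have S := sees_outer v yj; case: ifP => [/eqP <-|vc].
  by rewrite (collapse_sees S) invert_id.
have N d : (forall k, k != j -> d k) -> sgv d (invert (sgv d y)) = fun=> 0.
  move=> dj; rewrite (_ : sgv d y = fun k => - y k) ?invert_neg ?sgv0 //.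
    by move=> k; rewrite oppr_le0.
  apply/funext => k; rewrite /sgv; have [->|/dj ->] := eqVneq k j.
    by rewrite yj oppr0 mulr0.
  by rewrite mulN1r.
move: S => [[tv Ec]|[Tv tv Ec]]; rewrite /collapse.
  rewrite tv vc; case: ifP => // _; rewrite -Ec invert_neg ?sgv0 //.
  by move=> k; rewrite oppr_le0.
rewrite tv vc andbF; case: ifP => // _; rewrite invert_neg ?sgv0 // => k.
by rewrite -oppr_ge0 -[- _]/((fun k => - zcoord (outer_piece v j).2 y k) k) -Ec.
Qed.

Lemma collapse_eq c t t' y y' : t.1 = t'.1 -> zcoord t.2 y = zcoord t'.2 y' ->
  collapse c t y = collapse c t' y'.
Proof. by rewrite /collapse => -> ->. Qed.

(** This lets [collapse] descend to the realization. Crossing to the next slot flips the sign of a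
    coordinate that vanishes on the triangle; inside a cone or a tube the coordinates themselves
    agree. *)
Lemma collapse_glue c t j y y' : valid t -> in_simplex y -> y j = 0 ->
  (forall k, y' ((glue_piece t j).2 k) = y k) ->
  collapse c (glue_piece t j).1 y' = collapse c t y.
Proof.
move=> V ys yj.
case: (glue_cases pi j V) => [[v ->]|[v [i [-> ij Tv Cv ->]]]|[v [d [-> Tv md mf ->]]]].
- rewrite glue_outer /= => yy'; have -> : y' = y.
    by apply/funext => k; rewrite -yy' perm1.
  rewrite !collapse_outer //= /across /=; case: ifP => // _.
  apply/funext => k; rewrite /sgv ffunE.
  by have [->|] := eqVneq k j; rewrite ?yj ?mulr0 // addbF.
- by move=> yy'; apply: collapse_eq => //; exact: coord_cone_glue ij yj yy'.
- move=> yy'; have -> : y' = y by apply/funext => k; rewrite -yy' perm1.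
  by apply: collapse_eq => //; exact: coord_tube_glue.
Qed.

End Collapse.
End Coordinates.

(** * Injectivity of the collapsing maps off the cores *)

Section Triangulation.
Variables (k : nat) (tubed : pred signs) (pi : signs -> {perm 'I_k}).
Variable coned : pred (slot k).
Variables (n : nat) (decode : 'I_n -> piece k) (encode : piece k -> 'I_n).
Hypothesis valid_decode : forall t, valid_piece tubed coned (decode t).
Hypothesis decodeK : cancel decode encode.
Hypothesis encodeK : forall p, valid_piece tubed coned p -> decode (encode p) = p.
Local Notation partner := (partner pi).
Local Notation valid := (valid_piece tubed coned).
Local Notation outer_piece := (outer_piece tubed pi coned).
Local Notation glue_piece := (glue_piece tubed pi coned).
Local Notation tube_piece := (tube_piece pi).

Definition design_gluing : gluing n :=
  [ffun f => let g := glue_piece (decode f.1) f.2 in (encode g.1, g.2)].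

Lemma design_face_pairing : face_pairing design_gluing.
Proof.
apply/forallP => -[t i].
have Vg := valid_glue pi i (valid_decode t).
have gK := glueK pi i (valid_decode t).
rewrite /mate !ffunE /= !encodeK // !gK /= permK decodeK !eqxx !andbT.
apply/eqP => -[E Ei]; have := glue_neq pi i (valid_decode t).
by rewrite -(encodeK Vg) E Ei eqxx.
Qed.

Variable R : realType.
Local Notation S := (set_type (@simplex3 R)).
Local Notation sees := (@sees R k tubed pi).
Local Notation collapse := (@collapse R k tubed pi).
Implicit Types (v : slot k) (x y : S) (z : 'I_4 -> R) (p : piece k).

Definition pt p x : tetrahedra R n := existT (fun _ => S) (encode p) x.
Definition same p x q y : Prop :=
  clos_refl_sym_trans _ (@face_glued R n design_gluing) (pt p x) (pt q y).

Lemma same_refl p x : same p x p x.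
Proof. exact: rst_refl. Qed.

Lemma same_sym p x q y : same p x q y -> same q y p x.
Proof. exact: rst_sym. Qed.

Lemma same_trans p x q y r w : same p x q y -> same q y r w -> same p x r w.
Proof. exact: rst_trans. Qed.

Lemma same_step p x y j : valid p -> bary x j = 0 ->
  (forall i, bary y ((glue_piece p j).2 i) = bary x i) ->
  same p x (glue_piece p j).1 y.
Proof.
move=> V xj yx; apply: rst_step; exists j; rewrite /= ffunE /= encodeK //.
Qed.

(** Face [j] of a tube piece contains [x] when its coordinate [j] is 0; crossing it flips the sign
    at [j]. The walk from [d] to [d'] must avoid the two missing facets. *)
Lemma same_tube v d d' x : tubed v.2 -> mixed d -> mixed d' ->
  (forall i, bary x i != 0 -> d i = d' i) ->
  same (tube_piece v d) x (tube_piece v d') x.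
Proof.
move=> Tv md md' dd'.
have [i0 x0] : exists i0, bary x i0 != 0.
  apply: contrapT => /forallNP H; have [_] := baryP x.
  rewrite big1 => [/esym/eqP|i _]; first by rewrite oner_eq0.
  by apply/eqP; move: (H i) => /negP; rewrite negbK.
have [b bE] : exists b, d i0 = b by exists (d i0).
(* Signs at zero coordinates are set to the opposite of the sign at [i0], where [x] is nonzero. Both
   signs occur throughout, and the walks from [d] and from [d'] end at the same piece. *)
pose mix (e : signs) (s : seq 'I_4) : signs :=
  [ffun i => if (i \in s) && (bary x i == 0) then ~~ b else e i].
have mmix e s : mixed e -> e i0 = b -> mixed (mix e s).
  move=> /andP[/existsP[i ei] /existsP[j ej]] eb.
  have m0 : mix e s i0 = b by rewrite ffunE (negPf x0) andbF.
  have [l ml] : exists l, mix e s l = ~~ b.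
    have [l el] : exists l, e l = ~~ b.
      by case: (b); [exists j; exact/negbTE|exists i].
    by exists l; rewrite ffunE el; case: ifP.
  rewrite /mixed; apply/andP; split; apply/existsP.
    by move: m0 ml; case: (b) => m0 ml; [exists i0; rewrite m0|exists l; rewrite ml].
  by move: m0 ml; case: (b) => m0 ml; [exists l; rewrite ml|exists i0; rewrite m0].
have path e s : mixed e -> e i0 = b ->
    same (tube_piece v e) x (tube_piece v (mix e s)) x.
  move=> me eb; elim: s => [|j s IH].
    rewrite (_ : mix e [::] = e); first exact: same_refl.
    by apply/ffunP => i; rewrite ffunE.
  have [->//|ne] := eqVneq (mix e (j :: s)) (mix e s).
  have fE : mix e (j :: s) = flip j (mix e s) /\ bary x j = 0.
    have [xj|xj] := eqVneq (bary x j) 0; last first.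
      case/eqP: ne; apply/ffunP => i; rewrite !ffunE in_cons.
      by have [->|//] := eqVneq i j; rewrite (negPf xj) !andbF.
    split=> //; apply/ffunP => i; rewrite !ffunE in_cons.
    have [->|_] := eqVneq i j; last by rewrite addbF.
    rewrite xj eqxx !andbT /=; case: ifP => js.
      case/eqP: ne; apply/ffunP => l; rewrite !ffunE in_cons.
      by have [->|//] := eqVneq l j; rewrite js.
    rewrite addbT; congr (~~ _); apply/eqP; apply/negPn/negP => bj.
    case/eqP: ne; apply/ffunP => l; rewrite !ffunE in_cons.
    have [->|//] := eqVneq l j; rewrite js xj eqxx /=.
    by move: bj; case: (b); case: (e j).
  apply: same_trans IH _.
  have V : valid (tube_piece v (mix e s)) by apply: valid_tube => //; exact: mmix.
  have := same_step (y := x) V fE.2.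
  rewrite glue_tube ?mmix // -fE.1 mmix //=; apply => i.
  by rewrite perm1.
have d'b : d' i0 = b by rewrite -dd'.
apply: same_trans (path d (enum 'I_4) md bE) _.
rewrite (_ : mix d _ = mix d' (enum 'I_4)); first by apply/same_sym/path.
apply/ffunP => i; rewrite !ffunE mem_enum inE /=.
by case: ifP => // /negbT; exact: dd'.
Qed.

Lemma same_coord v p x q y z : valid p -> valid q ->
  sees v p (bary x) z -> sees v q (bary y) z -> same p x q y.
Proof.
move=> Vp Vq Sp Sq; have [Tv|Tv] := boolP (tubed v.2).
  have [d [md -> zd]] := sees_tube Tv Vp Sp.
  have [d' [md' -> zd']] := sees_tube Tv Vq Sq.
  have xy : x = y.
    apply/bary_inj/funext => i.
    have := sgv_abs d (bary x) i; have := sgv_abs d' (bary y) i.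
    rewrite -zd -zd' => ->.
    by rewrite !ger0_norm; [move=> ->|case: (baryP x)|case: (baryP y)].
  rewrite -xy in zd' *; apply: same_tube => // i xi.
  have := congr1 (fun f => f i) (etrans (esym zd) zd'); rewrite /sgv.
  by move=> /(mulIf xi) /signr_inj.
case: Sp => [[pv zp]|[]]; last by rewrite (negPf Tv).
case: Sq => [[qv zq]|[]]; last by rewrite (negPf Tv).
move: Vp Vq (Vp); rewrite /valid pv qv (negPf Tv) /=.
case: p q pv qv zp zq => v1 [i|d] [v2 [j|d']] /= -> -> zp zq.
- move=> Cv _ Vp; have [ij|ij] := eqVneq i j.
    move: zp; rewrite zq ij => /coord_cone_inj/bary_inj ->; exact: same_refl.
  have [xj yx] := coord_cone_swap ij (baryP x) (baryP y) (etrans (esym zp) zq).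
  have := same_step (p := (v, inl i)) (y := y) _ xj.
  rewrite /glue_piece /= (negPf ij) /=; apply=> //.
  by rewrite /valid_piece /= Tv Cv.
- by move=> -> /andP[].
- by move=> /andP[/negPf ->].
- move=> /andP[_ /eqP dE] /andP[_ /eqP d'E] _; subst d d'.
  suff -> : x = y by exact: same_refl.
  by apply: bary_inj; rewrite -[LHS](sgvK no_signs) -zp zq sgvK.
Qed.

Lemma same_across v p x z j : valid p -> sees v p (bary x) z ->
  (forall i, 0 <= z i) -> z j = 0 ->
  exists q y, [/\ valid q, sees (across j v) q (bary y) z & same p x q y].
Proof.
move=> V Sp z0 zj.
have [y yz] : exists y, bary y = z.
  apply: bary_surj; split=> //; rewrite -l1norm_id //.
  exact: sees_l1norm (baryP x) Sp.
have Sv : sees v (outer_piece v j) (bary y) z by rewrite yz; exact: sees_outer.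
exists (outer_piece (across j v) j), y; split.
- exact: valid_outer.
- by rewrite yz; exact: sees_outer.
- apply: same_trans (same_coord V (valid_outer _ _ _ _ _) Sp Sv) _.
  have := same_step (x := y) (y := y) (j := j) (valid_outer tubed pi coned v j).
  by rewrite glue_outer /= yz => /(_ zj); apply => i; rewrite perm1.
Qed.

(** One triangle is crossed for each sign in which [e] and [e'] differ. *)
Lemma same_boundary c e e' p x q y z : valid p -> valid q ->
  sees (c, e) p (bary x) z -> sees (c, e') q (bary y) z ->
  (forall i, 0 <= z i) -> (forall i, e i != e' i -> z i = 0) ->
  same p x q y.
Proof.
move=> Vp Vq Sp Sq z0 ee'.
pose mix (s : seq 'I_4) : signs := [ffun i => if i \in s then e' i else e i].
have [q' [y' [Vq' Sq' S']]] : exists q' y',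
    [/\ valid q', sees (c, mix (enum 'I_4)) q' (bary y') z & same p x q' y'].
  elim: (enum _) => [|j s [q' [y' [Vq' Sq' S']]]].
    exists p, x; split=> //; last exact: same_refl.
    by rewrite (_ : mix [::] = e) //; apply/ffunP => i; rewrite ffunE.
  have [E|ne] := eqVneq (mix (j :: s)) (mix s).
    by exists q', y'; split=> //; rewrite E.
  have ej : e j != e' j.
    apply/eqP => ej; case/eqP: ne; apply/ffunP => l; rewrite !ffunE in_cons.
    by have [->|//] := eqVneq l j; rewrite -ej; case: ifP.
  have js : j \notin s.
    apply/negP => js; case/eqP: ne; apply/ffunP => l; rewrite !ffunE in_cons.
    by have [->|//] := eqVneq l j; rewrite js.
  have [r [w [Vr Sr Sw]]] := same_across Vq' Sq' z0 (ee' _ ej).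
  exists r, w; split=> //; last exact: same_trans S' Sw.
  rewrite (_ : mix (j :: s) = flip j (mix s)) //.
  apply/ffunP => l; rewrite !ffunE in_cons.
  have [->|_] := eqVneq l j; last by rewrite addbF.
  by rewrite (negPf js) addbT /=; move: ej; case: (e j); case: (e' j).
apply: same_trans S' (same_coord Vq' Vq Sq' _).
by rewrite (_ : mix _ = e') //; apply/ffunP => i; rewrite ffunE mem_enum inE.
Qed.

(* Away from the cores of its tubed facets, the sphere |z| = 1 of a copy is
   the injective image of its neighbourhood in the manifold. *)
Definition chart_target (f : 'I_4 -> R) : Prop :=
  forall e, tubed e -> ~ ((forall i, 0 <= sgv e f i) /\ core f).

Variable e0 : signs.
Hypothesis tubed_e0 : tubed e0.

(** The value 0 lies in every closed orthant and in [core], so one tubed facet keeps it out of the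
    target. *)
Lemma chart_target_neq0 f : chart_target f -> exists i, f i != 0.
Proof.
move=> Vf; apply: contrapT => /forallNP H; apply: (Vf e0 tubed_e0).
have f0 : f = fun=> 0.
  by apply/funext => i; apply/eqP; move: (H i) => /negP; rewrite negbK.
rewrite f0; split=> [i|]; first by rewrite sgv0.
rewrite /core (_ : unlift4 _ = fun=> 0).
  rewrite /pos_sum big1 ?mulr0 ?l1norm_ge0 // => i _.
  by rewrite maxxx.
apply/funext => i; rewrite /unlift4 normr0 (@min4_eq _ _ 0) ?mulr0 ?subrr //.
Qed.

Lemma core_invert e z : core (invert z) -> core (sgv e (invert z)).
Proof. by apply: core_abs => i; rewrite sgv_abs. Qed.

(* Over the chart target the value of [invert] determines its argument. *)
Lemma chart_target_sees v p x z : valid p -> sees v p (bary x) z ->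
  chart_target (sgv v.2 (invert z)) ->
  [/\ \sum_i invert z i = 1,
      ~~ tubed v.2 -> z = invert z,
      tubed v.2 -> z = fun i => unlift4 (invert z) i /
                                l1norm (unlift4 (invert z)) &
      forall j, invert z j = 0 -> z = invert z].
Proof.
move=> Vp Sp Vf; have z1 := sees_l1norm (baryP x) Sp.
have [Tv|Tv] := boolP (tubed v.2).
  have zm := sees_min4 Tv Vp (baryP x) Sp.
  have nc : ~ core (invert z).
    move=> /(core_invert v.2) cz; apply: (Vf _ Tv); split=> // i.
    by rewrite sgvK; exact: invert_ge0.
  have [P1 sz zE] := invertP z1 zm nc; split=> // j qj.
  rewrite [LHS]zE; apply/funext => i.
  have uq : unlift4 (invert z) = invert z.
    apply/funext => l; rewrite /unlift4 (@min4_eq _ _ 0).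
    + by rewrite mulr0 subr0 ger0_norm // invert_ge0.
    + by move=> ?.
    + by exists j; rewrite qj normr0.
  rewrite uq l1norm_id ?sz ?divr1 // => l; exact: invert_ge0.
have [z0 sz] := sees_untubed Tv Vp (baryP x) Sp.
by rewrite (invert_id z0 sz); split.
Qed.

(** Absolute values of the common image give [invert z = invert z'], and the signs of the two slots
    differ only where this vanishes. For equal slots [invert] is undone; otherwise the point is on
    the boundary of its facet, where [invert] is the identity. *)
Lemma collapse_inj c p x q y : valid p -> valid q ->
  chart_target (collapse c p (bary x)) ->
  collapse c p (bary x) = collapse c q (bary y) -> same p x q y.
Proof.
move=> Vp Vq Vf E; have [i fi] := chart_target_neq0 Vf.
have [e [z Sp]] := sees_collapse fi.
have [e' [z' Sq]] : exists e z, sees (c, e) q (bary y) z.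
  by apply: (sees_collapse (k := i)); rewrite -E.
have pE := collapse_sees Sp; have qE := collapse_sees Sq; rewrite /= in pE qE.
have zz' : invert z = invert z'.
  apply/funext => l; rewrite -[LHS]ger0_norm ?invert_ge0 // -[RHS]ger0_norm ?invert_ge0 //.
  by rewrite -(sgv_abs e) -pE E qE sgv_abs.
have Vz : chart_target (sgv e (invert z)) by rewrite -pE.
have Vz' : chart_target (sgv e' (invert z')) by rewrite -qE -E.
have [sz zu zt zb] := chart_target_sees Vp Sp Vz.
have [sz' zu' zt' zb'] := chart_target_sees Vq Sq Vz'.
have ee' l : e l != e' l -> invert z l = 0.
  move=> el; have := congr1 (fun f => f l) (etrans (esym pE) (etrans E qE)).
  rewrite /= -zz' /sgv; move: el; case: (e l); case: (e' l) => //= _.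
    by rewrite expr0 expr1 mulN1r mul1r; lra.
  by rewrite expr0 expr1 mulN1r mul1r; lra.
have [ee|/eqP/ffunP ne] := eqVneq e e'.
  rewrite -{}ee in Sq Vz' zu' zt' *; apply: (same_coord Vp Vq Sp).
  suff -> : z = z' by [].
  have [Te|Te] := boolP (tubed e); last by rewrite zu // zz' -zu'.
  by rewrite zt // zz' -zt'.
have [l el] : exists l, e l != e' l.
  by apply: contrapT => /forallNP H; apply: ne => l; apply/eqP; move: (H l) => /negP; rewrite negbK.
have q0 := ee' l el.
have zE := zb l q0; have zE' : z' = z by rewrite zE zz'; apply: (zb' l); rewrite -zz'.
rewrite zE' in Sq; apply: (same_boundary Vp Vq Sp Sq) => [m|m /ee' zm].
  by rewrite zE invert_ge0.
by rewrite zE.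
Qed.

End Triangulation.

(** * Charts of the sphere and the manifold property *)

Lemma continuous_mull (R : realType) (T : topologicalType) (a : R) (f : T -> R) :
  continuous f -> continuous (fun x => a * f x).
Proof. by move=> cf x; apply: cvgM; [exact: cvg_cst|exact: cf]. Qed.

Lemma continuous_subl (R : realType) (T : topologicalType) (a : R) (f : T -> R) :
  continuous f -> continuous (fun x => a - f x).
Proof. by move=> cf x; apply: cvgB; [exact: cvg_cst|exact: cf]. Qed.

Definition row_fun (R : realType) (p : 'rV[R]_4) : 'I_4 -> R := fun i => p ord0 i.

(** Where coordinate [i0] has the fixed sign [e], the sphere is the graph of e * (1 - sum of |w j|)
    over the other three coordinates. *)
Lemma l1_sphere_chart (R : realType) (V : set 'rV[R]_4) (p : 'rV[R]_4) :
  open V -> V p -> l1norm (row_fun p) = 1 ->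
  exists (N : set 'rV[R]_4) (W : set 'rV[R]_3)
    (h : 'rV[R]_4 -> 'rV[R]_3) (l : 'rV[R]_3 -> 'rV[R]_4),
    [/\ open N, open W, N `<=` V, continuous h & continuous l] /\
    [/\ N p,
        forall q, N q -> l1norm (row_fun q) = 1 -> W (h q) /\ l (h q) = q &
        forall w, W w -> [/\ N (l w), h (l w) = w & l1norm (row_fun (l w)) = 1]].
Proof.
move=> oV Vp p1.
have [i0 pi0] : exists i, p ord0 i != 0.
  apply: contrapT => /forallNP H; move: p1; rewrite /l1norm big1 => [/esym/eqP|i _].
    by rewrite oner_eq0.
  by apply/normr0P; move: (H i) => /negP; rewrite negbK.
pose e : R := (-1) ^+ (p ord0 i0 < 0)%R.
have ee (a : R) : e * (e * a) = a by rewrite /e signrMK.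
have ea (a : R) : `|e * a| = `|a| by rewrite /e normrMsign.
pose N := V `&` [set q : 'rV[R]_4 | 0 < e * q ord0 i0].
pose h (q : 'rV[R]_4) : 'rV[R]_3 := \row_j q ord0 (lift i0 j).
pose l (w : 'rV[R]_3) : 'rV[R]_4 :=
  \row_i if unlift i0 i is Some j then w ord0 j else e * (1 - \sum_j `|w ord0 j|).
have lj w j : l w ord0 (lift i0 j) = w ord0 j by rewrite mxE liftK.
have l0 w : l w ord0 i0 = e * (1 - \sum_j `|w ord0 j|) by rewrite mxE unlift_none.
have normE (q : 'rV[R]_4) :
    l1norm (row_fun q) = `|q ord0 i0| + \sum_j `|h q ord0 j|.
  rewrite /l1norm (bigD1_ord i0) //=; congr (_ + _).
  by apply: eq_bigr => j _; rewrite mxE.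
have hl w : h (l w) = w by apply/rowP => j; rewrite mxE lj.
have ch : continuous h.
  apply: mx_continuous => i j; rewrite (_ : (fun q => _) = fun q : 'rV[R]_4 => q ord0 (lift i0 j)).
    exact: coord_continuous.
  by apply/funext => q; rewrite mxE.
have cl : continuous l.
  apply: mx_continuous => i j; case: (unliftP i0 j) => [m jE|jE].
    rewrite (_ : (fun w => _) = fun w : 'rV[R]_3 => w ord0 m).
      exact: coord_continuous.
    by apply/funext => w; rewrite (ord1 i) jE lj.
  rewrite (_ : (fun w => _) = fun w : 'rV[R]_3 => e * (1 - \sum_j `|w ord0 j|)).
    apply/continuous_mull/continuous_subl.
    apply: (@sum_continuous _ _ _ (fun j (w : 'rV[R]_3) => `|w ord0 j|)) => m u.
    by apply: continuous_comp; [exact: coord_continuous|exact: norm_continuous].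
  by apply/funext => w; rewrite (ord1 i) jE l0.
have oN : open N.
  apply: openI => //; apply: (@open_comp _ _ (fun q : 'rV[R]_4 => e * q ord0 i0) [set y | 0 < y]).
    move=> q _; apply: (@continuous_mull _ _ e (fun q : 'rV[R]_4 => q ord0 i0)).
    exact: coord_continuous.
  exact: open_gt.
exists N, (l @^-1` N), h, l; split; split=> //.
- by apply: open_comp => // w _; exact: cl.
- by move=> q [].
- split=> //=; rewrite /e; have [p0|p0] := ltP (p ord0 i0) 0.
    by rewrite expr1 mulN1r oppr_gt0.
  by rewrite expr0 mul1r lt_def pi0.
- move=> q Nq q1; have [Vq /= eq0] := Nq.
  suff lhq : l (h q) = q by split=> //=; rewrite lhq.
  apply/rowP => i; case: (unliftP i0 i) => [m ->|->]; first by rewrite lj mxE.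
  have -> : l (h q) ord0 i0 = e * `|q ord0 i0|.
    by rewrite l0; congr (_ * _); rewrite -q1 normE addrK.
  by rewrite -ea gtr0_norm // ee.
- move=> w Nw; split=> //; rewrite normE hl l0 ea.
  have [_ /= ] := Nw; rewrite l0 ee => /gtr0_norm ->.
  by rewrite subrK.
Qed.

Lemma sgv_continuous (R : realType) (T : topologicalType) (y : T -> 'I_4 -> R) e i :
  (forall j, continuous (fun x => y x j)) -> continuous (fun x => sgv e (y x) i).
Proof. by move=> cy; exact: continuous_mull. Qed.

Lemma zcoord_continuous (R : realType) (T : topologicalType) (y : T -> 'I_4 -> R) q i :
  (forall j, continuous (fun x => y x j)) -> continuous (fun x => zcoord q (y x) i).
Proof.
move=> cy; case: q => [j|d]; last exact: sgv_continuous.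
move=> x; apply: cvgD; first exact: continuous_mull.
by apply: cvgM; [exact: cy|exact: cvg_cst].
Qed.

Lemma collapse_continuous (R : realType) (T : topologicalType) (y : T -> 'I_4 -> R)
    k tubed (pi : signs -> {perm 'I_k}) c p i :
  (forall x, in_simplex (y x)) ->
  (forall j, continuous (fun x => y x j)) ->
  continuous (fun x => collapse tubed pi c p (y x) i).
Proof.
move=> ys cy; rewrite /collapse; have [_|_] := boolP (p.1.1 == c).
  apply: sgv_continuous => j.
  apply: (@invert_continuous _ _ (fun x => zcoord p.2 (y x))) => [l|x].
    exact: zcoord_continuous.
  exact: l1norm_coord.
case: (_ && _); last by move=> x; exact: cvg_cst.
apply: sgv_continuous => j.
apply: (@invert_continuous _ _ (fun x l => - zcoord p.2 (y x) l)) => [l x|x].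
  by apply: cvgN; exact: zcoord_continuous.
by rewrite l1normN; exact: l1norm_coord.
Qed.

Section Charts.
Variables (R : realType) (k : nat) (tubed : pred signs) (pi : signs -> {perm 'I_k}).
Variable coned : pred (slot k).
Variable e0 : signs.
Hypothesis tubed_e0 : tubed e0.
Local Notation valid := (valid_piece tubed coned).
Local Notation S := (set_type (@simplex3 R)).
Local Notation sees := (@sees R k tubed pi).
Local Notation collapse := (@collapse R k tubed pi).
Local Notation chart_target := (@chart_target tubed R).

Lemma chart_cover p (x : S) : valid p -> exists c, chart_target (collapse c p (bary x)).
Proof.
move=> Vp; have xs := baryP x.
have [Tp|Tp] := boolP (tubed p.1.2); last first.
  have Sp : sees p.1 p (bary x) (zcoord p.2 (bary x)) by left.
  have [z0 sz] := sees_untubed Tp Vp xs Sp.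
  exists p.1.1; rewrite (collapse_sees Sp) invert_id // => e Te [e0' Ce].
  (* A tubed orthant differs from that of the slot in some sign [j]. A common point has coordinate
     [j] zero, which keeps it out of the core. *)
  have [j ej] : exists j, e j != p.1.2 j.
    apply: contrapT => /forallNP H; suff E : e = p.1.2 by rewrite -E Te in Tp.
    by apply/ffunP => j; apply/eqP; move: (H j) => /negP; rewrite negbK.
  have zj : zcoord p.2 (bary x) j = 0.
    apply/le_anti; rewrite z0 andbT; have := e0' j; rewrite /sgv.
    by move: ej; case: (e j); case: (p.1.2 j) => //= _;
      rewrite !(expr0, expr1, mul1r, mulN1r) oppr_ge0.
  apply: (@not_core_boundary _ _ j) Ce; last by rewrite /sgv zj mulr0.
  by rewrite l1norm_sgv l1norm_coord.
(* One of the two ends sees a positive part above 1/4. *)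
have [v [z [Tv Sp P1]]] : exists v z,
    [/\ tubed v.2, sees v p (bary x) z & 1 < 4 * pos_sum z].
  have [P1|P1] := ltP 1 (4 * pos_sum (zcoord p.2 (bary x))).
    by exists p.1, (zcoord p.2 (bary x)); split=> //; left.
  exists (partner pi p.1), (fun i => - zcoord p.2 (bary x) i).
  rewrite partner_signs; split=> //; first by right; rewrite partner_signs.
  have := pos_sum_neg (zcoord p.2 (bary x)); rewrite l1norm_coord // => E; lra.
exists v.1; rewrite (collapse_sees Sp) => e Te [_ Ce].
apply: (invert_notcore (sees_l1norm xs Sp) (sees_min4 Tv Vp xs Sp) P1).
by apply: core_abs Ce => i; rewrite sgv_abs.
Qed.

Lemma chart_norm c p (x : S) : valid p -> chart_target (collapse c p (bary x)) ->
  l1norm (collapse c p (bary x)) = 1.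
Proof.
move=> Vp Vf; have [i fi] := chart_target_neq0 tubed_e0 Vf.
have [e [z Sp]] := sees_collapse fi; have pE := collapse_sees Sp.
rewrite /= in pE; rewrite pE in Vf *.
have [sz _ _ _] := chart_target_sees Vp Sp Vf.
by rewrite l1norm_sgv l1norm_id // => j; exact: invert_ge0.
Qed.

Lemma chart_surj c (f : 'I_4 -> R) : l1norm f = 1 -> chart_target f ->
  exists p (x : S), valid p /\ collapse c p (bary x) = f.
Proof.
move=> f1 Vf; pose e : signs := [ffun i => f i < 0].
pose q i := `|f i|; have q0 i : 0 <= q i by exact: normr_ge0.
have fE : f = sgv e q.
  apply/funext => i; rewrite /sgv /q ffunE; have [fi|fi] := ltP (f i) 0.
    by rewrite ltr0_norm // expr1 mulN1r opprK.
  by rewrite ger0_norm // expr0 mul1r.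
have q1 : \sum_i q i = 1 by [].
have [Te|Te] := boolP (tubed e); last first.
  have [Ce|Ce] := boolP (coned (c, e)).
    have [i [y [ys yq]]] := coord_cone_surj (conj q0 q1).
    have [x xy] := bary_surj ys.
    exists ((c, e), inl i), x; split; first by rewrite /valid_piece /= Te.
    have Sp : sees (c, e) ((c, e), inl i) (bary x) q by left; rewrite xy yq.
    by rewrite (collapse_sees Sp) invert_id.
  have [x xq] := bary_surj (conj q0 q1).
  exists ((c, e), inr no_signs), x; split.
    by rewrite /valid_piece /= (negPf Te) Ce eqxx.
  have Sp : sees (c, e) ((c, e), inr no_signs) (bary x) q.
    left; split=> //; rewrite xq; apply/funext => i /=.
    by rewrite /sgv ffunE mul1r.
  by rewrite (collapse_sees Sp) invert_id.
have nc : ~ core q.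
  move=> Cq; apply: (Vf e Te); split=> [i|]; first by rewrite fE sgvK.
  by apply: core_abs Cq => i; rewrite normr_id.
have [z [z1 zm P1 zq bz]] := invert_surj q0 q1 nc.
have [x xz] : exists x : S, bary x = fun i => `|z i|.
  by apply: bary_surj; split.
have [d [md dz]] : exists d, mixed d /\ sgv d (fun i => `|z i|) = z.
  pose d : signs := [ffun i => z i < 0].
  have dz : sgv d (fun i => `|z i|) = z.
    apply/funext => i; rewrite /sgv ffunE; have [zi|zi] := ltP (z i) 0.
      by rewrite ltr0_norm // expr1 mulN1r opprK.
    by rewrite ger0_norm // expr0 mul1r.
  have [md|] := boolP (mixed d); first by exists d.
  rewrite negb_and !negb_exists => /orP[|] /forallP dH.
    (* The signs of [z] are all positive, but it has a zero coordinate [j], where the sign may be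
       changed to give [hot j]. *)
    have z0 i : 0 <= z i by have := dH i; rewrite ffunE -leNgt.
    have [j qj] := bz z0; exists (hot j); split; first exact: mixed_hot.
    have zE : z = q by rewrite -zq invert_id // -l1norm_id.
    apply/funext => i; rewrite /sgv ffunE ger0_norm //.
    by have [->|] := eqVneq i j; rewrite ?zE ?qj ?mulr0 ?mul1r.
  have : pos_sum z = 0.
    rewrite /pos_sum big1 // => i _; rewrite max_l // ltW //.
    by have := dH i; rewrite negbK ffunE.
  by move: P1 => /[swap] ->; rewrite mulr0 ltr10.
exists (tube_piece pi (c, e) d), x; split; first exact: valid_tube.
have Sp : sees (c, e) (tube_piece pi (c, e) d) (bary x) z.
  by rewrite -[X in sees _ _ _ X]dz xz; exact: tube_sees.
by rewrite (collapse_sees Sp) zq.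
Qed.

Lemma chart_target_open : open [set p : 'rV[R]_4 | chart_target (row_fun p)].
Proof.
have cF e : tubed e -> closed [set p : 'rV[R]_4 |
    (forall i, 0 <= sgv e (row_fun p) i) /\ core (row_fun p)].
  move=> Te; have -> : [set p : 'rV[R]_4 |
    (forall i, 0 <= sgv e (row_fun p) i) /\ core (row_fun p)] =
    (\bigcap_i (fun p : 'rV[R]_4 => sgv e (row_fun p) i) @^-1` [set y | 0 <= y]) `&`
    [set p | core (row_fun p)].
    by apply/seteqP; split => p /= [p0 p1]; split=> // i; [move=> _|]; exact: p0.
  apply: closedI; last by apply: core_closed => i; exact: coord_continuous.
  apply: closed_bigI => i _; apply: closed_comp; last exact: closed_ge.
  move=> p _; apply: (@continuous_mull _ _ _ (fun q : 'rV[R]_4 => q ord0 i)).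
  exact: coord_continuous.
have -> : [set p : 'rV[R]_4 | chart_target (row_fun p)] =
  ~` (\bigcup_(e in [set e | tubed e]) [set p : 'rV[R]_4 |
    (forall i, 0 <= sgv e (row_fun p) i) /\ core (row_fun p)]).
  apply/seteqP; split => p /=.
    by move=> Vp [e Te He]; exact: Vp Te He.
  by move=> H e Te He; apply: H; exists e.
rewrite openC; apply: closed_bigcup => //; exact: finite_finset.
Qed.

Variables (n : nat) (decode : 'I_n -> piece k) (encode : piece k -> 'I_n).
Hypothesis valid_decode : forall t, valid (decode t).
Hypothesis decodeK : cancel decode encode.
Hypothesis encodeK : forall p, valid p -> decode (encode p) = p.
Local Notation G := (design_gluing tubed pi coned decode encode).

Lemma bary_continuous i : continuous (fun x : S => bary x i).
Proof.
move=> x; apply: (@continuous_comp _ _ _ set_val (fun y : 'rV[R]_4 => y ord0 i)).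
  exact: set_val_continuous.
exact: coord_continuous.
Qed.

Lemma design_manifold : manifold R 3 (realization R G).
Proof.
pose g c (a : tetrahedra R n) : 'rV[R]_4 :=
  \row_i collapse c (decode (projT1 a)) (bary (projT2 a)) i.
have gE c a : row_fun (g c a) = collapse c (decode (projT1 a)) (bary (projT2 a)).
  by apply/funext => i; rewrite /row_fun mxE.
have liftP c : exists f : realization R G -> 'rV[R]_4,
    continuous f /\ forall a, f (realization_pt G a) = g c a.
  apply: realization_lift => [t|a b [j [aj bt ba]]].
    apply: mx_continuous => i j.
    rewrite (_ : (fun x => _) = fun x : S => collapse c (decode t) (bary x) j).
      apply: (@collapse_continuous _ _ (fun x : S => bary x)) => [x|m].
        exact: baryP.
      exact: bary_continuous.
    by apply/funext => x; rewrite mxE.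
  apply/rowP => i; rewrite !mxE; congr (_ i); apply/esym.
  move: bt ba; rewrite ffunE /= => -> ba.
  rewrite encodeK; last exact: valid_glue.
  by apply: collapse_glue => //; exact: baryP.
pose f c := sval (cid (liftP c)).
have cf c : continuous (f c) := (svalP (cid (liftP c))).1.
have fE c a : f c (realization_pt G a) = g c a := (svalP (cid (liftP c))).2 a.
have frow c a : row_fun (f c (realization_pt G a)) =
    collapse c (decode (projT1 a)) (bary (projT2 a)) by rewrite fE gE.
have row_inj : injective (@row_fun R).
  by move=> p q pq; apply/rowP => i; exact: (congr1 (fun h => h i) pq).
apply: (@manifold_of_collapses R _ 4 3 ('I_k * bool)%type f
   (fun=> [set p : 'rV[R]_4 | chart_target (row_fun p)])).
- exact: realization_compact.
- exact: cf.
- by move=> _; exact: chart_target_open.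
- move=> X; have [a <-] := realization_pt_surj X.
  have [c Hc] := chart_cover (projT2 a) (valid_decode (projT1 a)).
  by exists c; rewrite /= frow.
- move=> c X Y; have [a <-] := realization_pt_surj X.
  have [b <-] := realization_pt_surj Y => /=; rewrite frow => Vf E.
  apply: realization_pt_eq.
  have Eab : collapse c (decode (projT1 a)) (bary (projT2 a)) =
      collapse c (decode (projT1 b)) (bary (projT2 b)) by rewrite -!frow E.
  have := collapse_inj encodeK tubed_e0 (valid_decode (projT1 a))
    (valid_decode (projT1 b)) Vf Eab; rewrite /same /pt !decodeK.
  by case: (a) (b) => [? ?] [? ?].
- move=> c X /=; have [a <-] := realization_pt_surj X => Vf.
  have p1 : l1norm (row_fun (f c (realization_pt G a))) = 1.
    by move: Vf; rewrite frow; exact: chart_norm.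
  have [N [W [h [l [Top [Np hN lW]]]]]] := l1_sphere_chart chart_target_open Vf p1.
  exists N, W, h, l; split=> //; split=> // [Y|w Ww].
    have [b <-] := realization_pt_surj Y => NY; apply: hN => //.
    case: Top => _ _ /(_ _ NY) /=; rewrite frow => VY _ _.
    exact: chart_norm.
  have [Nlw hlw lw1] := lW w Ww; split=> //.
  have Vlw : chart_target (row_fun (l w)) by case: Top => _ _ /(_ _ Nlw).
  have [p [x [Vp px]]] := chart_surj c lw1 Vlw.
  exists (realization_pt G (pt encode p x)); apply: row_inj.
  by rewrite frow /= encodeK.
Qed.

End Charts.

(** * Counting *)

Definition all_signs : signs := [ffun=> true].

Definition tubed3 : pred signs :=
  fun e => [|| e == no_signs, e == all_signs | e == hot ord0].

(** * Walks along faces glued alike in the whole family *)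

Section Family.
Variable k : nat.
Variable coned : pred (slot k).
Implicit Types (v : slot k) (p q : piece k) (s : {perm 'I_k}).

(** Tubes at [all_signs] join the two copies of a pair; those at [hot ord0] lead from pair i to pair
    i + 1 modulo k. *)
Definition matching s (e : signs) : {perm 'I_k} :=
  if e == no_signs then s else if e == all_signs then 1%g else perm (@ordS_inj k).

Local Notation valid := (valid_piece tubed3 coned).
Local Notation outer s := (outer_piece tubed3 (matching s) coned).
Local Notation glue s := (glue_piece tubed3 (matching s) coned).

Definition linked p q : Prop := exists j g, forall s, glue s p j = (q, g).

(** The equivalence generated by links, stated as its induction principle. The predicate is
    reachability in [family_triangulation] and agreement of two isomorphisms in [iso_rigid]. *)
Definition joined p q : Prop := forall P : piece k -> Prop,
  (forall p q, valid p -> linked p q -> (P p <-> P q)) -> (P p <-> P q).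

Lemma joined_refl p : joined p p.
Proof. by move=> P _. Qed.

Lemma joined_sym p q : joined p q -> joined q p.
Proof. by move=> pq P HP; have [] := pq P HP; split. Qed.

Lemma joined_trans p q r : joined p q -> joined q r -> joined p r.
Proof.
move=> pq qr P HP; have [pq1 pq2] := pq P HP; have [qr1 qr2] := qr P HP.
by split; auto.
Qed.

Lemma linked_joined p q : valid p -> linked p q -> joined p q.
Proof. by move=> V L P HP; exact: HP. Qed.

Lemma linked_sym p q : valid p -> linked p q -> linked q p.
Proof.
move=> V [j [g H]]; exists (g j), (g^-1)%g => s.
by have := glueK (matching s) j V; rewrite H.
Qed.

Lemma linked_valid p q : valid p -> linked p q -> valid q.
Proof. by move=> V [j [g H]]; have := valid_glue (matching 1%g) j V; rewrite H. Qed.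

Lemma joined_flip v d j : v.1.2 -> tubed3 v.2 -> mixed d -> mixed (flip j d) ->
  joined (v, inr d) (v, inr (flip j d)).
Proof.
move=> sv Tv md mf; apply: linked_joined; first by rewrite /valid_piece /= Tv sv.
by exists j, 1%g => s; rewrite /glue_piece /= Tv mf.
Qed.

Lemma joined_hot v i j : v.1.2 -> tubed3 v.2 ->
  joined (v, inr (hot i)) (v, inr (hot j)).
Proof.
move=> sv Tv; have [->|ij] := eqVneq i j; first exact: joined_refl.
have E : flip i (flip j (hot i)) = hot j.
  by apply/ffunP => l; rewrite !ffunE addbAC addbb addFb.
have mp : mixed (flip j (hot i)).
  apply/andP; split; apply/existsP.
    by exists i; rewrite !ffunE eqxx (negPf ij).
  have /card_gt0P[l lij] : (0 < #|~: [set i; j]|)%N.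
    by have := cardsC [set i; j]; rewrite cards2 card_ord; case: (i != j) => /=; lia.
  exists l; move: lij; rewrite !inE negb_or !ffunE => /andP[/negPf -> /negPf ->].
  by [].
apply: joined_trans (joined_flip sv Tv (mixed_hot i) mp) _.
by rewrite -E; apply: joined_flip => //; rewrite E mixed_hot.
Qed.

Lemma joined_tube v d d' : v.1.2 -> tubed3 v.2 -> mixed d -> mixed d' ->
  joined (v, inr d) (v, inr d').
Proof.
move=> sv Tv; suff H e : mixed e -> joined (v, inr e) (v, inr (hot ord0)).
  by move=> md md'; apply: joined_trans (H _ md) (joined_sym (H _ md')).
move=> me; have /andP[/existsP[i ei] /existsP[j ej]] := me.
apply: (joined_trans _ (joined_hot i ord0 sv Tv)).
(* Negative signs other than that at [i] are dropped one by one, ending at [hot i]; the signs at [i]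
   and [j] keep every stage mixed. *)
pose mix (s : seq 'I_4) : signs := [ffun l => e l && ((l == i) || (l \notin s))].
have mm (s : seq 'I_4) : mixed (mix s).
  apply/andP; split; apply/existsP; first by exists i; rewrite ffunE ei eqxx.
  by exists j; rewrite ffunE (negPf ej).
suff : joined (v, inr e) (v, inr (mix (enum 'I_4))).
  congr (joined _ (_, inr _)); apply/ffunP => l; rewrite !ffunE mem_enum inE orbF.
  by have [->|_] := eqVneq l i; rewrite ?ei ?andbF.
elim: (enum _) => [|l s IH].
  rewrite (_ : mix [::] = e); first exact: joined_refl.
  by apply/ffunP => l; rewrite ffunE orbT andbT.
have [->//|ne] := eqVneq (mix (l :: s)) (mix s).
suff E : mix (l :: s) = flip l (mix s).
  by apply: joined_trans IH _; rewrite E; apply: joined_flip => //; rewrite -E.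
apply/ffunP => m; rewrite !ffunE in_cons.
have [ml|_] := eqVneq m l; last by rewrite addbF.
rewrite ml /= orbF addbT; apply/eqP; case: eqP => // /eqP H; case/eqP: ne.
apply/ffunP => m'; rewrite !ffunE in_cons.
have [->|//] := eqVneq m' l; rewrite /= orbF.
by move: H; case: (e l); case: (l == i); case: (l \in s).
Qed.

(* Slots whose pieces do not depend on the matching. *)
Definition free v : bool := v.1.2 || (v.2 != no_signs).

Lemma outer_free v j s s' : free v -> outer s v j = outer s' v j.
Proof.
rewrite /free /outer_piece /tube_piece /partner /matching.
by case: (v.1.2) => //= /negPf ->.
Qed.

Lemma joined_outer v i j : free v -> joined (outer 1%g v i) (outer 1%g v j).
Proof.
move=> fv; rewrite /outer_piece; case: ifP => Tv.
  rewrite /tube_piece; case: ifP => sv; first by apply: joined_tube => //; exact: mixed_hot.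
  apply: joined_tube; rewrite ?mixed_opp ?mixed_hot ?partner_signs //.
  by rewrite partner_side sv.
case: ifP => Cv; last exact: joined_refl.
have [->|ij] := eqVneq i j; first exact: joined_refl.
apply: linked_joined; first by rewrite /valid_piece /= Tv Cv.
by exists j, (tperm i j) => s; rewrite /glue_piece /= (negPf ij).
Qed.

Lemma joined_across v j : free v -> free (across j v) ->
  joined (outer 1%g v ord0) (outer 1%g (across j v) ord0).
Proof.
move=> fv fw; apply: joined_trans (joined_outer ord0 j fv) _.
apply: joined_trans (joined_outer j ord0 fw).
apply: linked_joined; first exact: valid_outer.
exists j, 1%g => s; rewrite (outer_free j 1%g s fv) glue_outer.
by rewrite (outer_free j s 1%g fw).
Qed.

(** Adding negative signs one at a time never produces [no_signs], so the walk stays among free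
    slots. *)
Lemma joined_copy c e : free (c, e) ->
  joined (outer 1%g (c, e) ord0) (outer 1%g (c, all_signs) ord0).
Proof.
move=> fe; pose mix (s : seq 'I_4) : signs := [ffun l => e l || (l \in s)].
have fm (s : seq 'I_4) : free (c, mix s).
  move: fe; rewrite /free /=; case: (c.2) => //= /eqP ne; apply/eqP => mE.
  apply: ne; apply/ffunP => l; have := congr1 (fun f : signs => f l) mE.
  by rewrite !ffunE; case: (e l).
suff : joined (outer 1%g (c, e) ord0) (outer 1%g (c, mix (enum 'I_4)) ord0).
  rewrite (_ : mix _ = all_signs) //.
  by apply/ffunP => l; rewrite !ffunE mem_enum inE orbT.
elim: (enum _) => [|l s IH].
  rewrite (_ : mix [::] = e); first exact: joined_refl.
  by apply/ffunP => l; rewrite ffunE orbF.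
have [->//|ne] := eqVneq (mix (l :: s)) (mix s).
have E : mix (l :: s) = flip l (mix s).
  apply/ffunP => m; rewrite !ffunE in_cons.
  have [ml|_] := eqVneq m l; last by rewrite addbF.
  rewrite ml /= orbT addbT; apply/esym/negP => H; case/eqP: ne.
  apply/ffunP => m'; rewrite !ffunE in_cons.
  by have [->|//] := eqVneq m' l; rewrite orbT; move: H; case: (e l) => //= ->.
apply: joined_trans IH _; have := @joined_across (c, mix s) l (fm s).
by rewrite /across /= -E; apply; exact: fm.
Qed.

Lemma joined_partner i e : tubed3 e -> e != no_signs ->
  joined (outer 1%g (i, true, e) ord0) (outer 1%g (matching 1%g e i, false, e) ord0).
Proof.
move=> Te eA; rewrite /outer_piece /= Te /tube_piece /= /partner /= permK.
by apply: joined_tube => //; rewrite ?mixed_opp mixed_hot.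
Qed.

Lemma hot_neq_no j : hot j != no_signs.
Proof. by apply/eqP => /ffunP /(_ j); rewrite !ffunE eqxx. Qed.

Lemma all_neq_no : all_signs != no_signs.
Proof. by apply/eqP => /ffunP /(_ ord0); rewrite !ffunE. Qed.

Lemma hot_neq_all j : hot j != all_signs.
Proof.
apply/eqP => /ffunP /(_ (lift j ord0)); rewrite !ffunE eq_sym.
by rewrite (negPf (neq_lift _ _)).
Qed.

Lemma joined_sides i : joined (outer 1%g (i, true, all_signs) ord0)
  (outer 1%g (i, false, all_signs) ord0).
Proof.
have := @joined_partner i all_signs; rewrite /matching (negPf all_neq_no) eqxx perm1.
by apply=> //; rewrite /tubed3 eqxx orbT.
Qed.

(** The route goes through the tube at [hot ord0] to the other side of the next pair, and back
    through the tube at [all_signs]. *)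
Lemma joined_next i : joined (outer 1%g (i, true, all_signs) ord0)
  (outer 1%g (ordS i, true, all_signs) ord0).
Proof.
have Th : tubed3 (hot ord0) by rewrite /tubed3 eqxx !orbT.
have := joined_partner i Th (hot_neq_no _).
rewrite /matching (negPf (hot_neq_no _)) (negPf (hot_neq_all _)) permE => H.
apply: joined_trans (joined_sym (joined_copy (e := hot ord0) _)) _ => //.
apply: joined_trans H _.
apply: joined_trans (joined_copy _) (joined_sym (joined_sides _)).
by rewrite /free /= hot_neq_no.
Qed.

Lemma joined_root i j : joined (outer 1%g (i, true, all_signs) ord0)
  (outer 1%g (j, true, all_signs) ord0).
Proof.
suff H (a b : 'I_k) : (a <= b)%N -> joined (outer 1%g (a, true, all_signs) ord0)
    (outer 1%g (b, true, all_signs) ord0).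
  by case: (leqP i j) => [|/ltnW] ij; [apply: H|apply: joined_sym; apply: H].
case: b => b bk /=; elim: b bk => [|b IH] bk ab.
  rewrite (_ : a = Ordinal bk); first exact: joined_refl.
  by apply: val_inj => /=; lia.
have [ab'|ab'] := leqP a b; last first.
  rewrite (_ : a = Ordinal bk); first exact: joined_refl.
  by apply: val_inj => /=; lia.
apply: joined_trans (IH (ltnW bk) ab') _.
have := joined_next (Ordinal (ltnW bk)).
rewrite (_ : ordS _ = Ordinal bk) //; apply: val_inj => /=.
by rewrite modn_small.
Qed.

Lemma joined_all p q : valid p -> valid q -> joined p q.
Proof.
suff H p' : valid p' -> exists i,
    joined p' (outer 1%g (i, true, all_signs) ord0).
  move=> /H[i pi] /H[j qj]; apply: joined_trans pi _.
  exact: joined_trans (joined_root i j) (joined_sym qj).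
move=> Vp.
have [fp pO] : free p'.1 /\ joined p' (outer 1%g p'.1 ord0).
  case: p' Vp => [v t] Vp /=.
  have [Tv|Tv] := boolP (tubed3 v.2).
    move: Vp; rewrite /valid_piece /= Tv; case: t => [//|d] /andP[sv md].
    split; first by rewrite /free sv.
    rewrite /outer_piece Tv /tube_piece sv.
    by apply: joined_tube => //; exact: mixed_hot.
  have fv : free v.
    by rewrite /free orbC; move: Tv; rewrite /tubed3; case: eqP.
  split=> //; move: (Vp); rewrite /valid_piece /= (negPf Tv); case: t Vp => [i|d] Vp.
    move=> /= Cv; have := joined_outer i ord0 fv.
    by rewrite {1}/outer_piece (negPf Tv) Cv.
  move=> /andP[/negPf Cv /eqP ->]; rewrite /outer_piece (negPf Tv) Cv.
  exact: joined_refl.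
case: p'.1 fp pO => -[i b] e fp pO; exists i.
apply: joined_trans pO _; apply: joined_trans (joined_copy fp) _.
case: b {fp}; first exact: joined_refl.
by apply: joined_sym; apply: joined_sides.
Qed.

Lemma glue_matching_inj s s' :
  (forall p j, valid p -> glue s p j = glue s' p j) -> s = s'.
Proof.
(* The far end of the tube at (i, true, [no_signs]) borders on copy (s i, false), so its gluing
   shows [s i]. Taking [j] different from [ord0] makes the neighbour [hot j] untubed, hence a piece
   stored at its own slot. *)
move=> H; apply/permP => i; pose j : 'I_4 := lift ord0 ord0.
have Tn : tubed3 no_signs by rewrite /tubed3 eqxx.
have Th : tubed3 (hot j) = false.
  rewrite /tubed3 (negPf (hot_neq_no _)) (negPf (hot_neq_all _)) /=.
  by apply/eqP => /ffunP /(_ ord0); rewrite !ffunE.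
have mo : mixed (opp_signs (hot j)) by rewrite mixed_opp mixed_hot.
have V : valid ((i, true, no_signs), inr (opp_signs (hot j))).
  by rewrite /valid_piece /= Tn mo.
have fo : ~~ mixed (flip j (opp_signs (hot j))).
  by rewrite -opp_flip mixed_opp flip_hot mixed_no_signs.
have hE : flip j no_signs = hot j by rewrite -(flip_hot j) flipK.
have E t : (glue t ((i, true, no_signs), inr (opp_signs (hot j))) j).1.1.1.1 = t i.
  rewrite /glue_piece /= Tn (negPf fo) !ffunE eqxx /= /partner /= /across /= hE.
  by rewrite /outer_piece /= Th /matching eqxx; case: ifP.
by rewrite -E H // E.
Qed.

End Family.

(** * The number of tetrahedra *)

Lemma card_signs : #|signs| = 16%N.
Proof. by rewrite card_ffun card_bool card_ord. Qed.

Lemma mixedE d : mixed d = (d \in ~: [set no_signs; all_signs]).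
Proof.
rewrite !inE negb_or /mixed; congr (_ && _); apply/idP/idP.
- by move=> /existsP[i di]; apply/eqP => dE; rewrite dE ffunE in di.
- move=> /eqP H; apply/negbNE/negP; rewrite negb_exists => /forallP H'; apply: H.
  by apply/ffunP => i; rewrite ffunE; apply/negbTE.
- by move=> /existsP[i di]; apply/eqP => dE; rewrite dE ffunE in di.
- move=> /eqP H; apply/negbNE/negP; rewrite negb_exists => /forallP H'; apply: H.
  by apply/ffunP => i; rewrite ffunE; apply/negbNE.
Qed.

Lemma card_mixed : #|[pred d | mixed d]| = 14%N.
Proof.
have C : #|~: [set no_signs; all_signs]| = 14%N.
  have := cardsC [set no_signs; all_signs].
  by rewrite cards2 eq_sym all_neq_no card_signs /=; lia.
by rewrite -[RHS]C; apply: eq_card => d; rewrite inE mixedE.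
Qed.

Lemma card_tubed3 : #|tubed3| = 3%N.
Proof.
rewrite (eq_card (B := mem (no_signs |: [set all_signs; hot ord0]))).
  rewrite cardsU1 cards2 !inE eq_sym (negPf all_neq_no).
  by rewrite eq_sym (negPf (hot_neq_no _)) eq_sym hot_neq_all.
by move=> d; rewrite !inE.
Qed.

Lemma sum_tubed3 (a : nat) :
  (\sum_(e : signs) (if tubed3 e then a else 1) = 3 * a + 13)%N.
Proof.
rewrite (bigID tubed3) /= (eq_bigr (fun=> a)) => [|e ->//].
rewrite [X in (_ + X)%N](eq_bigr (fun=> 1%N)) => [|e /negPf ->//].
rewrite !sum_nat_const card_tubed3 muln1.
by congr (_ + _)%N; have := cardC tubed3; rewrite card_tubed3 card_signs => -[].
Qed.

(** A pair has 2 * 13 facets that are kept and 3 tubes of 14 pieces, in all 68; coning a facet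
    replaces one tetrahedron by four. *)
Lemma card_valid k (Q : {set slot k}) : (forall v, v \in Q -> ~~ tubed3 v.2) ->
  #|[pred p | valid_piece tubed3 (fun v => v \in Q) p]| = (68 * k + 3 * #|Q|)%N.
Proof.
move=> QT; rewrite -[LHS]sum1_card big_mkcond /=.
have -> : (\sum_(p : piece k)
    (if p \in [pred p | valid_piece tubed3 (fun v => v \in Q) p] then 1 else 0) =
  \sum_(v : slot k) \sum_(q : 'I_4 + signs)
   (valid_piece tubed3 (fun v => v \in Q) (v, q)))%N.
  rewrite pair_bigA /=; apply: eq_bigr => -[v q] _.
  by rewrite inE; case: valid_piece.
have E (v : slot k) : (\sum_(q : 'I_4 + signs)
   (valid_piece tubed3 (fun v => v \in Q) (v, q)) =
   (if tubed3 v.2 then (if v.1.2 then 14 else 0) else 1) + 3 * (v \in Q))%N.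
  rewrite big_sumType /= /valid_piece /= sum_nat_const card_ord.
  case: ifP => Tv /=.
    have -> : (v \in Q) = false.
      by apply/negbTE/negP => /QT; rewrite Tv.
    case: ifP => _ /=; last by rewrite big1.
    by rewrite muln0 addn0 add0n -card_mixed -sum1_card [in RHS]big_mkcond.
  case: (v \in Q) => /=; first by rewrite big1.
  by rewrite (bigD1 no_signs) //= eqxx big1 // => d /negPf ->.
rewrite (eq_bigr _ (fun v _ => E v)) big_split /= -big_distrr /=.
congr (_ + 3 * _)%N; last by rewrite -sum1_card [in RHS]big_mkcond.
rewrite -(pair_bigA _ (fun (c : 'I_k * bool) (e : signs) =>
  if tubed3 e then if c.2 then 14 else 0 else 1)%N) /=.
rewrite (eq_bigr (fun c : 'I_k * bool => 3 * (if c.2 then 14 else 0) + 13)%N); last first.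
  by move=> c _; rewrite sum_tubed3.
rewrite -(pair_bigA _ (fun (i : 'I_k) (b : bool) => 3 * (if b then 14 else 0) + 13)%N) /=.
have E68 (i : 'I_k) : true ->
    (\sum_(b : bool) (3 * (if b then 14 else 0) + 13) = 68)%N.
  by move=> _; rewrite big_bool.
by rewrite (eq_bigr _ E68) sum_nat_const card_ord mulnC.
Qed.

Lemma exists_subset_card (T : finType) (A : {set T}) m : (m <= #|A|)%N ->
  exists2 Q : {set T}, {subset Q <= A} & #|Q| = m.
Proof.
move=> mA; exists [set x in take m (enum A)].
  by move=> x; rewrite inE => /mem_take; rewrite mem_enum.
rewrite cardsE; have /card_uniqP -> : uniq (take m (enum A)).
  by rewrite take_uniq // enum_uniq.
by rewrite size_take -cardE; case: ltngtP mA.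
Qed.

Lemma enumeration (T : finType) (P : pred T) n : (0 < n)%N -> #|P| = n ->
  exists (decode : 'I_n -> T) (encode : T -> 'I_n),
    [/\ forall t, P (decode t), cancel decode encode &
        forall p, P p -> decode (encode p) = p].
Proof.
move=> n0 Pn; have /card_gt0P[x0 Px0] : (0 < #|P|)%N by rewrite Pn.
exists (fun t => enum_val (cast_ord (esym Pn) t)).
exists (fun p => cast_ord Pn (enum_rank_in Px0 p)); split=> [t|t|p Pp].
- exact: (enum_valP (cast_ord (esym Pn) t)).
- by rewrite enum_valK_in cast_ordKV.
- by rewrite cast_ordK enum_rankK_in.
Qed.

(** * Counting isomorphism classes *)

Lemma isomorphic_refl n (G : gluing n) : isomorphic G G.
Proof.
apply/existsP; exists 1%g; apply/existsP; exists [ffun=> 1%g].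
apply/forallP => -[t i]; rewrite !ffunE /= !perm1 invg1 mul1g mulg1.
by case: (G (t, i)).
Qed.

Lemma card_le_fibers (T U : finType) (f : T -> U) (A : {set U}) m :
  (forall x, f x \in A) -> (forall y, (#|[pred x | f x == y]| <= m)%N) ->
  (#|T| <= #|A| * m)%N.
Proof.
move=> fA fm; rewrite -[X in (X <= _)%N]sum1_card (partition_big f (mem A)) //=.
apply: leq_trans (_ : \sum_(y in A) m <= _)%N; last by rewrite sum_nat_const.
apply: leq_sum => y _; apply: leq_trans (fm y).
by rewrite -sum1_card; apply: eq_leq; apply: eq_bigl.
Qed.

Section Counting.
Variables (R : realType) (k : nat) (coned : pred (slot k)) (n : nat).
Variables (decode : 'I_n -> piece k) (encode : piece k -> 'I_n).
Local Notation valid := (valid_piece tubed3 coned).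
Hypothesis valid_decode : forall t, valid (decode t).
Hypothesis decodeK : cancel decode encode.
Hypothesis encodeK : forall p, valid p -> decode (encode p) = p.
Local Notation G s := (design_gluing tubed3 (matching s) coned decode encode).

Lemma family_linked p q : valid p -> linked coned p q ->
  exists j g, forall s : {perm 'I_k}, G s (encode p, j) = (encode q, g).
Proof.
move=> V [j [g H]]; exists j, g => s.
by rewrite ffunE /= encodeK // H.
Qed.

Lemma family_triangulation (s : {perm 'I_k}) : (0 < n)%N ->
  manifold_triangulation R (G s).
Proof.
move=> n0; apply: manifold_triangulation_intro.
- exact: design_face_pairing.
- by apply: (@design_manifold _ _ _ _ _ no_signs) => //; rewrite /tubed3 eqxx.
- apply: (realization_connected (t0 := Ordinal n0)) => t.
  set r := fun _ => _.
  suff H : connect r (Ordinal n0) (encode (decode t)) by rewrite decodeK in H.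
  have := joined_all (valid_decode (Ordinal n0)) (valid_decode t).
  move=> /(_ (fun p => connect r (Ordinal n0) (encode p))) [] => [p q Vp L|+ _].
    have step p' q' : valid p' -> linked coned p' q' ->
        connect r (Ordinal n0) (encode p') -> connect r (Ordinal n0) (encode q').
      move=> V' /(family_linked V')[j [g Gj]] /connect_trans; apply.
      by apply/connect1/existsP; exists j; rewrite Gj.
    split; first exact: step.
    by apply: step; [exact: linked_valid L|exact: linked_sym].
  by apply; rewrite decodeK connect0.
Qed.

Lemma family_inj (s s' : {perm 'I_k}) : G s = G s' -> s = s'.
Proof.
move=> E; apply: (@glue_matching_inj _ coned) => p j Vp.
have := congr1 (fun g : gluing n => g (encode p, j)) E.
rewrite !ffunE /= encodeK // => -[/(congr1 decode)].
rewrite !encodeK ?valid_glue //.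
by case: glue_piece => ? ?; case: glue_piece => ? ? /= -> ->.
Qed.

Definition iso_of (A B : gluing n) (sw : {perm 'I_n} * {ffun 'I_n -> {perm 'I_4}}) :=
  [forall f : 'I_n * 'I_4,
      B (sw.1 f.1, sw.2 f.1 f.2)
      == (sw.1 (A f).1, ((sw.2 f.1)^-1 * (A f).2 * sw.2 (A f).1)%g)].

(* An isomorphism is determined by its value at one tetrahedron: it propagates
   along the faces that are glued alike in all members of the family. *)
Lemma iso_rigid (s s' : {perm 'I_k}) (B : gluing n) sw sw' t0 :
  iso_of (G s) B sw -> iso_of (G s') B sw' ->
  sw.1 t0 = sw'.1 t0 -> sw.2 t0 = sw'.2 t0 -> s = s'.
Proof.
move=> /forallP I /forallP I' e1 e2.
pose P p := sw.1 (encode p) = sw'.1 (encode p) /\ sw.2 (encode p) = sw'.2 (encode p).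
have step p q : valid p -> linked coned p q -> P p -> P q.
  move=> V /(family_linked V)[j [g Gj]] [p1 p2].
  have /eqP := I (encode p, j); have /eqP := I' (encode p, j).
  rewrite /= !Gj /= -p1 -p2 => -> [E1 E2]; split=> //.
  by move: E2; rewrite -!mulgA => /mulgI /mulgI.
have PT t : sw.1 t = sw'.1 t /\ sw.2 t = sw'.2 t.
  have := joined_all (valid_decode t0) (valid_decode t).
  move=> /(_ P) [] => [p q Vp L|+ _].
    split; first exact: step.
    by apply: step; [exact: linked_valid L|exact: linked_sym].
  by rewrite /P !decodeK; apply.
apply: family_inj; apply/ffunP => -[t i].
have /eqP := I (t, i); have /eqP := I' (t, i).
rewrite /= -(PT t).1 -(PT t).2 => -> [].
rewrite -(PT _).1 => /perm_inj E1; rewrite -(PT _).2 E1 -!mulgA => /mulgI /mulIg E2.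
by case: (G s (t, i)) E1 E2 => ? ?; case: (G s' (t, i)) => ? ? /= -> ->.
Qed.

Lemma family_count : (0 < n)%N ->
  (k`! <= num_triangulations R n * (n * 24))%N.
Proof.
move=> n0; set D := [set H : gluing n | `[< manifold_triangulation R H >]]%SET.
have GD s : G s \in D.
  by rewrite inE; apply/asboolP; exact: family_triangulation.
pose cl (s : {perm 'I_k}) := [set y in D | isomorphic (G s) y]%SET.
rewrite -card_Sn; apply: (card_le_fibers (f := cl)) => [s|y].
  exact: imset_f.
have [[s0 y0]|ny] := pselect (exists s0, cl s0 = y); last first.
  rewrite eq_card0 // => s; rewrite !inE; apply/eqP => cy.
  by apply: ny; exists s.
have iso s : cl s = y -> exists sw, iso_of (G s) (G s0) sw.
  move=> sy; have : G s0 \in cl s.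
    by rewrite sy -y0 inE GD isomorphic_refl.
  rewrite inE => /andP[_ /existsP[t /existsP[w H]]]; by exists (t, w).
pose t0 := Ordinal n0.
(* All members of the fibre are isomorphic to [G s0]. The image of [t0] with its vertex numbering
   takes n * 24 values and, by rigidity, determines [s]; the default is never reached in the
   fibre. *)
pose phi s := if [pick sw | iso_of (G s) (G s0) sw] is Some sw
  then (sw.1 t0, sw.2 t0) else (t0, 1%g).
apply: leq_trans (_ : #|{: 'I_n * {perm 'I_4}}| <= _)%N; last first.
  by rewrite card_prod card_ord card_Sn.
apply: (@leq_card_in _ _ phi) => s s'; rewrite !inE => /eqP sy /eqP sy'.
rewrite /phi; case: pickP => [sw I|N]; last first.
  by have [sw H] := iso s sy; have := N sw; rewrite H.
case: pickP => [sw' I'|N]; last first.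
  by have [sw' H] := iso s' sy'; have := N sw'; rewrite H.
by move=> [e1 e2]; exact: iso_rigid I I' e1 e2.
Qed.

End Counting.

Lemma card_untubed k : #|[set v : slot k | ~~ tubed3 v.2]%SET| = (26 * k)%N.
Proof.
have -> : [set v : slot k | ~~ tubed3 v.2]%SET =
    finset.setX [set: 'I_k * bool]%SET [set e | ~~ tubed3 e]%SET.
  by apply/setP => v; rewrite !inE.
rewrite cardsX cardsT card_prod card_ord card_bool.
have -> : #|[set e | ~~ tubed3 e]%SET| = 13%N; last by lia.
have := cardC tubed3; rewrite card_tubed3 card_signs => H.
rewrite cardsE; have : #|[predC tubed3]| = 13%N by lia.
by [].
Qed.

Lemma size_decomposition n : (1000 <= n)%N -> exists k q,
  [/\ n = (68 * k + 3 * q)%N, (q <= 26 * k)%N & (n <= 68 * k + 203)%N].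
Proof.
(* As 68 is -1 modulo 3, n - 68 * k is divisible by 3 when n + k is. Lowering the quotient by at
   most 2 achieves this and leaves a remainder of at most 67 + 2 * 68 = 203. *)
move=> n0; pose k := (n %/ 68 - (n %/ 68 + n) %% 3)%N.
by exists k, ((n - 68 * k) %/ 3)%N; rewrite /k; split; lia.
Qed.

Lemma triangulations_ge_fact (R : realType) n : (1000 <= n)%N -> exists k,
  (k`! <= num_triangulations R n * (n * 24))%N /\ (n <= 68 * k + 203)%N.
Proof.
move=> n0; have [k [q [nE qk nk]]] := size_decomposition n0.
exists k; split=> //.
have [Q QA Qq] : exists2 Q : {set slot k},
    {subset Q <= [set v : slot k | ~~ tubed3 v.2]%SET} & #|Q| = q.
  by apply: exists_subset_card; rewrite card_untubed.
have QT v : v \in Q -> ~~ tubed3 v.2 by move=> /QA; rewrite inE.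
have n1 : (0 < n)%N by lia.
have cV : #|[pred p | valid_piece tubed3 (fun v => v \in Q) p]| = n.
  by rewrite card_valid // Qq nE.
have [decode [encode [vd dK eK]]] := enumeration n1 cV.
exact: (@family_count R k (fun v => v \in Q) n decode encode).
Qed.

(** * From factorials to exponentials *)

Lemma expn_le_fact m j : (m ^ j <= (m + j)`!)%N.
Proof.
elim: j => [|j IH]; first by rewrite expn0 fact_gt0.
by rewrite addnS factS expnS leq_mul // leqW // leq_addr.
Qed.

Lemma triangulations_lower (R : realType) n : (200 * 1000 <= n)%N -> exists m,
  (n ^ m <= num_triangulations R n ^ 2)%N /\ (n <= 200 * m)%N.
Proof.
move=> n0; have [k [kf nk]] : exists k, (k`! <= num_triangulations R n * (n * 24))%N /\
    (n <= 68 * k + 203)%N by apply: triangulations_ge_fact; lia.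
set N := num_triangulations R n in kf *.
pose m := (k %/ 2)%N; have mk : (m + m <= k)%N by rewrite /m; lia.
have nm : (n <= 136 * m + 271)%N by rewrite /m; lia.
(* With N the number of classes, m^m <= N * n^2 and n <= m^2 give n^m <= N^2 * n^4; lowering the
   exponent by 4 absorbs n^4. *)
exists (m - 4)%N; split; last by lia.
have mN : (m ^ m <= N * n ^ 2)%N.
  apply: leq_trans (expn_le_fact m m) _; apply: leq_trans (_ : k`! <= _)%N.
    by apply: leq_fact.
  apply: leq_trans kf _; rewrite leq_mul2l -mulnn leq_mul2l; apply/orP; right.
  by apply/orP; right; lia.
have nm2 : (n <= m ^ 2)%N.
  rewrite -mulnn; apply: leq_trans (_ : 137 * m <= _)%N; first by lia.
  by rewrite leq_mul2r; apply/orP; right; lia.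
have n4 : (0 < n ^ 4)%N by rewrite expn_gt0; apply/orP; left; lia.
rewrite -(leq_pmul2r n4) -expnD subnK; last by lia.
apply: leq_trans (_ : (m ^ 2) ^ m <= _)%N; first by case: (m) nm2 => // m' H; rewrite leq_exp2r.
rewrite -expnM mulnC expnM; apply: leq_trans (_ : (N * n ^ 2) ^ 2 <= _)%N.
  by rewrite leq_exp2r.
by rewrite expnMn -expnM.
Qed.

(** A gluing is a table of n * 4 entries with n * 24 possible values each, and n * 24 <= n^2. *)
Lemma triangulations_upper (R : realType) n : (24 <= n)%N ->
  (num_triangulations R n <= n ^ (8 * n))%N.
Proof.
move=> n24; apply: leq_trans (leq_imset_card _ _) _.
apply: leq_trans (max_card _) _.
rewrite card_ffun !card_prod !card_ord card_Sn.
rewrite (_ : 8 * n = 2 * (n * 4))%N; last by lia.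
rewrite [X in (_ <= X)%N]expnM leq_exp2r; last by lia.
by rewrite -mulnn leq_mul2l (_ : 4`! = 24)%N // n24 orbT.
Qed.

(** In logarithms: n ln n <= c m ln n <= 2 c ln N. *)
Lemma expR_le_of_expn (R : realType) (c n m N : nat) : (0 < n)%N -> (0 < c)%N ->
  (n ^ m <= N ^ 2)%N -> (n <= c * m)%N ->
  expR ((2 * c%:R)^-1 * (n%:R * ln n%:R)) <= N%:R :> R.
Proof.
move=> n0 c0 lo nm.
have nmR : n%:R <= c%:R * m%:R :> R by rewrite -natrM ler_nat.
have N0 : (0 < N)%N.
  have : (0 < N ^ 2)%N by apply: leq_trans lo; rewrite expn_gt0 n0.
  by rewrite expn_gt0 orbF.
have N1 : 0 < N%:R :> R by rewrite ltr0n.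
have c1 : 0 < c%:R :> R by rewrite ltr0n.
have ln0 : 0 <= ln (n%:R : R) by rewrite ln_ge0 // ler1n.
rewrite -[leRHS]lnK ?posrE // ler_expR.
have lnX a b : (0 < a)%N -> ln ((a ^ b)%N%:R : R) = b%:R * ln a%:R.
  by move=> a0; rewrite natrX lnXn ?ltr0n // mulr_natl.
have H : m%:R * ln n%:R <= 2%N%:R * ln N%:R :> R.
  rewrite -!lnX //; rewrite ler_ln ?posrE ?ltr0n ?expn_gt0 ?N0 ?n0 //.
  by rewrite ler_nat.
rewrite ler_pdivrMl ?mulr_gt0 //.
have H1 := ler_wpM2r ln0 nmR.
have H2 := ler_wpM2l (ltW c1) H.
apply: le_trans H1 _; rewrite -mulrA; apply: le_trans H2 _.
by rewrite mulrA [_ * 2]mulrC.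
Qed.

Lemma le_expR_of_expn (R : realType) (c n N : nat) : (0 < n)%N ->
  (N <= n ^ (c * n))%N -> N%:R <= expR (c%:R * (n%:R * ln n%:R)) :> R.
Proof.
move=> n0 up; apply: le_trans (_ : (n ^ (c * n))%N%:R <= _); first by rewrite ler_nat.
rewrite natrX -[X in X ^+ _](lnK (x := n%:R)) ?posrE ?ltr0n // -expRM_natl.
by rewrite natrM mulrA.
Qed.

Theorem theorem3p1 (R : realType) :
  exists c1 c2 : R,
    [/\ 0 < c1, 0 < c2 &
        \forall n \near \oo,
          expR (c1 * (n%:R * ln n%:R)) <= (num_triangulations R n)%:R
            <= expR (c2 * (n%:R * ln n%:R))].
Proof.
exists ((2 * 200%N%:R)^-1), 8%N%:R; split.
- by rewrite invr_gt0 mulr_gt0 // ltr0n.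
- by rewrite ltr0n.
- near=> n.
  have large : (200 * 1000 <= n)%N by near: n; exact: nbhs_infty_ge.
  have n24 : (24 <= n)%N by apply: leq_trans large; rewrite -[24%N]muln1 leq_mul.
  have n0 : (0 < n)%N by apply: leq_trans n24.
  have [m [lo nm]] := triangulations_lower R large.
  apply/andP; split; first exact: expR_le_of_expn n0 _ lo nm.
  by apply: le_expR_of_expn n0 _; exact: triangulations_upper.
Unshelve. all: by end_near. Qed.
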